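(* There are functions $\zeta_s(n)$ (one for each positive integer $s$) of the form \begin{align*} \zeta_2(n) &= O(1), \quad \zeta_3(n) = O(\alpha(n)), \quad \zeta_4(n) = O(\alpha(n)^2), \quad \zeta_5(n) = O(\alpha(n) 2^{\alpha(n)}), \\ \zeta_{2t+3}(n) &= 2^{(1/t!)\alpha(n)^t + O(\alpha(n)^{t-1})} \qquad \text{for } t\geq 2, \text{ and} \\ \zeta_{2t+4}(n) &= 2^{(1/t!)\alpha(n)^t \log_2(\alpha(n)) + O(\alpha(n)^t)} \qquad \text{for } t\geq 1, \end{align*} such that for all positive integers $s,n$ and $B$, every $n\times n$ $(0,1)$-matrix $M$ with at least $\zeta_s(n)Bn$ $1$-entries contains a $B$-fat $(B,s)$-formation. More generally, for all positive integers $m,n,s$ and $B$, every $m\times n$ $(0,1)$-matrix $M$ with at least $\zeta_s(m)Bn$ $1$-entries contains a $B$-fat $(\lfloor nB/m\rfloor, s)$-formation.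
   Context: An $m\times n$ matrix has $m$ rows and $n$ columns. An $s$-partition of the rows of an $m\times n$ matrix is a partition of $\{1,\dots,m\}$ into $s$ intervals of consecutive integers $\{1=m_1,\dots,m_2-1\},\{m_2,\dots,m_3-1\},\dots,\{m_s,\dots,m\}$. A matrix $M$ contains a $B$-fat $(r,s)$-formation if there exist an $s$-partition of the rows and an $r$-tuple of (distinct) columns each of which has at least $B$ $1$-entries in each interval of rows of the partition. Inverse Ackermann function: $\alpha_1(m)=\lceil m/2\rceil$; $\alpha_d(1)=0$ for $d\ge 2$; $\alpha_d(m)=1+\alpha_d(\alpha_{d-1}(m))$ for $m,d\ge 2$; and $\alpha(m)=\min\{k\ge 1:\alpha_k(m)\le 3\}$. Asymptotic notation is for $n\to\infty$ with $s$ (equivalently $t$) fixed; implied constants depend only on $s$. *)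

(* Defs.v *)
From mathcomp Require Import all_boot all_order all_algebra.
From mathcomp Require Import all_classical all_reals all_analysis.
From mathcomp Require Import zify.
Import Order.TTheory GRing.Theory Num.Theory.
Import numFieldNormedType.Exports.

Set Implicit Arguments.
Unset Strict Implicit.
Unset Printing Implicit Defensive.

(* [iter_to1 f k m] is the number of applications of f taking m to a value
   <= 1, counted up to k; k = m suffices whenever f x < x for x >= 2. *)
Fixpoint iter_to1 (f : nat -> nat) (k m : nat) : nat :=
  if k is k'.+1 then
    if (m <= 1)%N then 0%N else (iter_to1 f k' (f m)).+1
  else 0%N.

(* The recursion alpha_d(m) = 1 + alpha_d(alpha_{d-1}(m)) is not structural in
   Rocq; its defining equations are [invack1], [invack_1] and [invack_rec]
   below. The values at d = 0 and at (d >= 2, m = 0) are junk. *)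
Fixpoint invack (d : nat) : nat -> nat :=
  match d with
  | 0 => id
  | 1 => uphalf
  | d'.+1 => fun m => iter_to1 (invack d') m m
  end.

Lemma iter_to1_le f k m : (forall x, 1 < x -> f x < x)%N ->
  (iter_to1 f k m <= m.-1)%N.
Proof.
move=> fl; elim: k m => //= k IH m; case: (leqP m 1) => // m1.
have fm := fl m m1; apply: (leq_ltn_trans (IH _)).
by lia.
Qed.

Lemma invackSS d m : invack d.+2 m = iter_to1 (invack d.+1) m m.
Proof. by []. Qed.

Lemma invack_lt d m : (0 < d)%N -> (1 < m)%N -> (invack d m < m)%N.
Proof.
case: d => // d _; elim: d m => [|d IH] m m1.
  by rewrite /=; have := uphalf_half m; have := odd_double_half m; lia.
rewrite invackSS; apply: (leq_ltn_trans (iter_to1_le _ _ IH)).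
by case: m m1.
Qed.

Lemma iter_to1_fuel f k k' m : (forall x, 1 < x -> f x < x)%N ->
  (m <= k)%N -> (m <= k')%N -> iter_to1 f k m = iter_to1 f k' m.
Proof.
move=> fl; elim: k k' m => [|k IH] [|k'] m //=;
  rewrite ?leqn0; try by move=> *; have /eqP -> : m == 0%N by [].
move=> mk mk'; case: (leqP m 1) => // m1; congr _.+1.
by apply: IH; rewrite -ltnS; apply: leq_trans (fl m m1) _.
Qed.

Lemma invack1 m : invack 1 m = uphalf m.
Proof. by []. Qed.

Lemma invack_1 d : (2 <= d)%N -> invack d 1 = 0%N.
Proof. by case: d => [|[]]. Qed.

Lemma invack_rec d m : (2 <= d)%N -> (2 <= m)%N ->
  invack d m = (1 + invack d (invack d.-1 m))%N.
Proof.
case: d => [|[|d]] // _ m2; rewrite add1n invackSS [d.+2.-1]/= invackSS.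
have fl := @invack_lt d.+1 ^~ isT.
case: m m2 => // m m2; rewrite {1}/iter_to1 -/iter_to1 leqNgt m2 /=.
by congr _.+1; apply: iter_to1_fuel => //; rewrite -ltnS; apply: fl.
Qed.

Lemma invack_le_sub2 d m : (0 < d)%N -> (4 <= m)%N -> (invack d m <= m - 2)%N.
Proof.
case: d => // d _; elim: d m => [|d IH] m m4.
  by rewrite /=; have := uphalf_half m; have := odd_double_half m; lia.
have m2 : (1 < m)%N by apply: leq_trans m4.
rewrite invack_rec // [d.+2.-1]/=.
apply: leq_trans (IH m m4).
have mpos : (0 < invack d.+1 m)%N.
  case: d {IH} => [|d]; first by case: m m4 m2 => [|[]].
  by rewrite invack_rec.
case: (leqP (invack d.+1 m) 1) => h; last by rewrite add1n invack_lt.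
have -> : invack d.+1 m = 1%N by apply/eqP; rewrite eqn_leq h.
by rewrite invack_1.
Qed.

Lemma invack_le3_ex m : exists k, (1 <= k)%N && (invack k m <= 3)%N.
Proof.
suff H d : (exists k, (1 <= k)%N && (invack k m <= 3)%N) \/
           (invack d.+1 m <= m - d)%N.
  have [//|h] := H m.
  by exists m.+1; rewrite (leq_trans h) // subnn.
elim: d => [|d [?|IH]]; [right|by left|].
  rewrite subn0; case: (leqP m 1) => [|h]; first by case: m => [|[]].
  by apply: ltnW; apply: invack_lt.
case: (leqP (invack d.+1 m) 3) => h; first by left; exists d.+1.
right; have m2 : (2 <= m)%N.
  by apply: leq_trans (leq_trans (ltnW (ltnW h)) IH) (leq_subr _ _).
rewrite invack_rec // [d.+2.-1]/= subnS.
have h2 := @invack_le_sub2 d.+2 _ isT h.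
rewrite add1n; apply: leq_ltn_trans h2 _.
have : (invack d.+1 m - 2 < (invack d.+1 m).-1)%N.
  by case: (invack d.+1 m) h => [|[|[|x]]].
by move/leq_trans; apply; rewrite -!subn1 leq_sub2r.
Qed.

Definition inv_ackermann (n : nat) : nat := ex_minn (invack_le3_ex n).

Section Formations.
Variables m n : nat.

(* Rows are numbered from 0: the k-th interval (k < s) is
   {c k, ..., c (k+1) - 1}. As blocks of a partition, intervals are nonempty. *)
Definition row_partition (s : nat) (c : nat -> nat) : Prop :=
  [/\ c 0%N = 0%N, c s = m & forall k, (k < s)%N -> (c k < c k.+1)%N].

Definition ones (M : 'M[bool]_(m, n)) : nat :=
  #|[set ij : 'I_m * 'I_n | M ij.1 ij.2]|.

Definition contains_fat_formation (B r s : nat) (M : 'M[bool]_(m, n)) : Prop :=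
  exists (c : nat -> nat) (T : r.-tuple 'I_n),
    [/\ row_partition s c,
        uniq T
      & forall (j : 'I_n) (k : nat), j \in T -> (k < s)%N ->
          (B <= #|[set i : 'I_m | (c k <= i < c k.+1)%N && M i j]|)%N].

End Formations.

Local Open Scope ring_scope.
Local Open Scope classical_set_scope.

Definition log2 (R : realType) (x : R) : R := ln x / ln 2.

(* f(n) = 2 ^ (g(n) + O(h(n))) *)
Definition eq_exp2_bigO (R : realType) (f g h : nat -> R) : Prop :=
  exists2 e : nat -> R, e =O_\oo h
    & forall n, (0 < n)%N -> f n = 2 `^ (g n + e n).

(* Main.v *)
(** Nivasch's recurrences for formation-free sequences, run on weighted
    columns.  Merging every B consecutive rows turns M into a matrix with
    entries at most B (r = floor (n B / m) and about m / B rows, so that r times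
    the number of rows is O(n)), and "fat" means weight at least B in each
    interval.  Cut the rows into groups of t consecutive rows.  A heavy column
    is then local to one group, or heavy in the first, the last or a middle
    group that it meets (where shorter formations are avoided), or it stays heavy after each group is contracted to
    a single row.  Contraction raises the bound on the entries but lowers the
    level d of the inverse Ackermann hierarchy, if t is chosen exponential in
    alpha_(d-1).  Taking d = alpha(m) leaves O(r) heavy columns per row, where
    the required weight is given by a recursion in s and d; its growth is that of
    zeta_s.  Keeping track of the entry bound w separately from the column
    weight is what yields alpha^2 and alpha 2^alpha for s = 4 and s = 5, instead
    of larger exponentials. *)

Require Import Defs.
From mathcomp Require Import all_boot all_order all_algebra.
From mathcomp Require Import boolp zify.

Set Implicit Arguments.
Unset Strict Implicit.
Unset Printing Implicit Defensive.

(** * Weighted columns and formations *)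

Section Weights.
Local Open Scope nat_scope.

Definition wt (f : nat -> nat) (x y : nat) : nat := \sum_(x <= i < y) f i.

Lemma wt_cat f x y z : x <= y -> y <= z -> wt f x z = wt f x y + wt f y z.
Proof. by move=> xy yz; rewrite /wt (big_cat_nat xy yz). Qed.

Lemma wt_geq f x y : y <= x -> wt f x y = 0.
Proof. by move=> yx; rewrite /wt big_geq. Qed.

Lemma wt_gt0 f x y : 0 < wt f x y -> x < y.
Proof. by case: (ltnP x y) => // yx; rewrite wt_geq. Qed.

Lemma wt_sub f x x' y' y : x <= x' -> y' <= y -> wt f x' y' <= wt f x y.
Proof.
move=> xx yy; case: (leqP x' y') => [xy|/ltnW yx]; last by rewrite wt_geq.
rewrite (wt_cat f xx (leq_trans xy yy)) (wt_cat f xy yy); lia.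
Qed.

Lemma wt_leM f x y N :
  (forall i, x <= i < y -> f i <= N) -> wt f x y <= (y - x) * N.
Proof.
move=> fN; rewrite -sum_nat_const_nat /wt big_nat [leqRHS]big_nat.
by apply: leq_sum.
Qed.

Lemma wt_group f t x y :
  wt (fun g => wt f (g * t) (g.+1 * t)) x y = wt f (x * t) (y * t).
Proof.
case: (leqP x y) => [|/ltnW yx]; last first.
  by rewrite !wt_geq // leq_mul2r yx orbT.
elim: y => [|y IH]; first by rewrite leqn0 => /eqP->; rewrite !wt_geq.
rewrite leq_eqVlt => /orP[/eqP->|]; first by rewrite !wt_geq.
rewrite ltnS => xy; rewrite {1}/wt big_nat_recr //= -/(wt _ x y) IH //.
by rewrite -wt_cat // leq_mul2r ?leqnSn ?xy orbT.
Qed.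

(** The shortest suffix that reaches [B] weighs less than [B] without its first entry, and that
    entry is at most [N]. *)
Lemma wt_split_right f x y B N : 0 < B -> B <= wt f x y ->
  (forall i, x <= i < y -> f i <= N) ->
  exists z, [/\ x <= z, z < y, B <= wt f z y & wt f z y < B + N].
Proof.
move=> B0; have [n yE] := ubnP (y - x); elim: n x yE => // n IH x yE Bw fN.
have xy : x < y by apply: (@wt_gt0 f); apply: leq_trans Bw.
case: (leqP B (wt f x.+1 y)) => h.
  have [|i hi|z [xz zy Bz zN]] := IH x.+1 _ h; [by lia|by apply: fN; lia|].
  by exists z; split => //; lia.
exists x; split=> //; have fx : f x <= N by apply: fN; lia.
by rewrite (@wt_cat _ x x.+1) // {1}/wt big_nat1; lia.
Qed.

Lemma wt_split_left f x y B N : 0 < B -> B <= wt f x y ->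
  (forall i, x <= i < y -> f i <= N) ->
  exists z, [/\ x < z, z <= y, B <= wt f x z & wt f x z < B + N].
Proof.
move=> B0; elim: y => [|y IH] Bw fN.
  by move: (leq_trans B0 Bw) => /wt_gt0.
have xy : x <= y by rewrite -ltnS; apply: (@wt_gt0 f); apply: leq_trans Bw.
case: (leqP B (wt f x y)) => h.
  have [||z [xz zy Bz zN]] := IH => //.
    by move=> i hi; apply: fN; lia.
  by exists z; split => //; lia.
exists y.+1; split=> //.
have fy : f y <= N by apply: fN; lia.
rewrite (@wt_cat _ x y) // {2}/wt big_nat1; lia.
Qed.

End Weights.

Section Formations.
Local Open Scope nat_scope.
Variables (T : finType) (B r : nat).
Hypothesis B0 : 0 < B.
Implicit Types (W : T -> nat -> nat) (S U : {set T}).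

(* Column u is only looked at in the window of rows [x u, y u). *)
Definition formation W (x y : T -> nat) S q : Prop :=
  exists U (c : nat -> nat), [/\ U \subset S, r <= #|U| &
    forall u, u \in U -> [/\ x u <= c 0, c q <= y u &
      forall k, k < q -> B <= wt (W u) (c k) (c k.+1)]].

(** [P] prescribes the kind of window, while [k] and [w] are counted in units of [B]. Weights and
    windows are quantified inside, so that one bound serves the original rows and their
    contractions. *)
Definition bounded (P : nat -> nat -> Prop) (q k w N : nat) : Prop :=
  forall W x y S,
    (forall u, u \in S -> P (x u) (y u)) ->
    (forall u i, u \in S -> x u <= i < y u -> W u i <= w * B) ->
    (forall u, u \in S -> k * B <= wt (W u) (x u) (y u)) ->
    ~ formation W x y S q -> #|S| <= N.

Lemma formation_subset W x y S S' q :
  S' \subset S -> formation W x y S' q -> formation W x y S q.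
Proof. by move=> SS [U [c [US rU H]]]; exists U, c; rewrite (subset_trans US). Qed.

Lemma bounded_leq P q k w N N' : N <= N' -> bounded P q k w N -> bounded P q k w N'.
Proof. by move=> NN H W x y S h1 h2 h3 h4; apply: leq_trans NN; apply: H h4. Qed.

(** All windows end at [hi]. A suffix of weight at least [B] and below [(w + 1) * B] is cut off each
    of them, which leaves room for one more common interval ending at [hi]. *)
Lemma bounded_trim_right (P P' : nat -> nat -> Prop) q k w N hi :
  (forall x y z, P' x y -> x <= z < y -> P x z) ->
  (forall x y, P' x y -> y = hi) ->
  bounded P q k w N -> bounded P' q.+1 (k + w + 1) w N.
Proof.
move=> PP Phi H W x y S hP hW hk nF.
(* The implication makes the condition satisfiable outside [S] as well, so that [ex_minn] defines a
   cut for every [u]. *)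
have ex u : exists v, (u \in S) ==> [&& x u <= v, v < y u,
    B <= wt (W u) v (y u) & wt (W u) v (y u) < B + w * B].
  case uS : (u \in S); last by exists 0.
  have [||v [? ? ? ?]] := @wt_split_right (W u) (x u) (y u) B (w * B) B0.
  - by apply: leq_trans (hk u uS); rewrite leq_pmull // addn1.
  - by move=> i; apply: hW.
  by exists v; apply/and4P.
pose z u := ex_minn (ex u).
have hz u : u \in S -> [/\ x u <= z u, z u < y u, B <= wt (W u) (z u) (y u)
    & wt (W u) (z u) (y u) < B + w * B].
  by move=> uS; rewrite /z; case: ex_minnP => v; rewrite uS => /and4P.
apply: (H W x z S).
- by move=> u uS; have [h1 h2 _ _] := hz u uS; apply: (PP _ (y u)); [exact: hP|lia].
- by move=> u i uS ?; have [h1 h2 _ _] := hz u uS; apply: hW => //; lia.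
- move=> u uS; have [h1 h2 _ h4] := hz u uS; have := hk u uS.
  rewrite (@wt_cat _ (x u) (z u) (y u)) //; [lia|exact: ltnW].
move=> [U [c [US rU hU]]]; apply: nF.
(* All suffixes start at or after [c q], so the interval from [c q] to [hi] is fat for every column
   of [U]. *)
exists U, (fun k => if k <= q then c k else hi); split=> // u uU.
have uS := subsetP US u uU; have [h1 h2 h3] := hU u uU.
have yhi := Phi _ _ (hP u uS); have [_ _ h6 _] := hz u uS.
split=> //=; first by rewrite ltnn yhi.
move=> i; rewrite ltnS => iq; rewrite iq.
case: (ltnP i q) => iq'; first exact: h3.
have -> : i = q by lia.
by apply: leq_trans h6 _; rewrite yhi wt_sub.
Qed.

Lemma bounded_trim_left (P P' : nat -> nat -> Prop) q k w N lo :
  (forall x y z, P' x y -> x < z <= y -> P z y) ->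
  (forall x y, P' x y -> x = lo) ->
  bounded P q k w N -> bounded P' q.+1 (k + w + 1) w N.
Proof.
move=> PP Plo H W x y S hP hW hk nF.
have ex u : exists v, (u \in S) ==> [&& x u < v, v <= y u,
    B <= wt (W u) (x u) v & wt (W u) (x u) v < B + w * B].
  case uS : (u \in S); last by exists 0.
  have [||v [? ? ? ?]] := @wt_split_left (W u) (x u) (y u) B (w * B) B0.
  - by apply: leq_trans (hk u uS); rewrite leq_pmull // addn1.
  - by move=> i; apply: hW.
  by exists v; apply/and4P.
pose z u := ex_minn (ex u).
have hz u : u \in S -> [/\ x u < z u, z u <= y u, B <= wt (W u) (x u) (z u)
    & wt (W u) (x u) (z u) < B + w * B].
  by move=> uS; rewrite /z; case: ex_minnP => v; rewrite uS => /and4P.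
apply: (H W z y S).
- by move=> u uS; have [h1 h2 _ _] := hz u uS; apply: (PP (x u)); [exact: hP|lia].
- by move=> u i uS ?; have [h1 h2 _ _] := hz u uS; apply: hW => //; lia.
- move=> u uS; have [h1 h2 _ h4] := hz u uS; have := hk u uS.
  rewrite (@wt_cat _ (x u) (z u) (y u)) //; [lia|exact: ltnW].
move=> [U [c [US rU hU]]]; apply: nF.
exists U, (fun k => if k is k'.+1 then c k' else lo); split=> // u uU.
have uS := subsetP US u uU; have [h1 h2 h3] := hU u uU.
have xlo := Plo _ _ (hP u uS); have [_ _ h6 _] := hz u uS.
split=> //=; first by rewrite xlo.
move=> [|i] iq; last exact: h3.
by apply: leq_trans h6 _; rewrite xlo wt_sub.
Qed.

Lemma card_cover S (R : {set T}) (F : nat -> {set T}) lo hi N :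
  (forall u, u \in S -> u \in R \/ exists2 g, lo <= g < hi & u \in F g) ->
  (forall g, lo <= g < hi -> #|F g| <= N) ->
  #|S| <= #|R| + (hi - lo) * N.
Proof.
move=> cov FN.
have SF : S \subset R :|: \bigcup_(g < hi | lo <= g) F g.
  apply/subsetP => u uS; rewrite inE.
  case: (cov u uS) => [->//|[g /andP[lg gh] ug]].
  by apply/orP; right; apply/bigcupP; exists (Ordinal gh).
apply: leq_trans (subset_leq_card SF) _.
apply: leq_trans (leq_card_setU _ _) _; rewrite leq_add2l.
apply: (@leq_trans (\sum_(g < hi | lo <= g) #|F g|)).
  elim/big_rec2: _ => [|i A n _ IH]; first by rewrite cards0.
  by apply: leq_trans (leq_card_setU _ _) _; rewrite leq_add2l.
rewrite -sum_nat_const_nat big_geq_mkord.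
by apply: leq_sum => i lo_i; apply: FN; rewrite lo_i ltn_ord.
Qed.

(* In [inner], row x - 1 >= lo and row y < hi stand for entries of the column
   before and after its window, which need not be heavy. *)
Definition inner (lo hi x y : nat) := lo < x /\ x <= y < hi.
Definition left_end (lo hi x y : nat) := lo < x <= hi /\ y = hi.
Definition right_end (lo hi x y : nat) := x = lo /\ lo <= y < hi.
Definition whole (lo hi x y : nat) := x = lo /\ y = hi.

(** Windows with the same start have their whole extent as a common fat interval, so at most [r] of
    them occur for each start. *)
Lemma bounded_left1 lo hi w : bounded (left_end lo hi) 1 1 w (r * (hi - lo)).
Proof.
move=> W x y S hP _ hk nF.
rewrite mulnC -[leqRHS]add0n -(@cards0 T).
apply: (@card_cover _ _ (fun g => [set u in S | x u == g.+1])).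
  move=> u uS; right; have [h1 h2] := hP u uS; have := hk u uS.
  rewrite mul1n => /(leq_trans B0)/wt_gt0; rewrite h2 => xh.
  by exists (x u).-1; [lia|rewrite inE uS; apply/eqP; lia].
move=> g gh; case: (leqP #|_| r) => // /ltnW rF; case: nF.
exists [set u in S | x u == g.+1], (fun k => if k is 0 then g.+1 else hi).
split=> //; first by apply/subsetP => u; rewrite inE => /andP[].
move=> u; rewrite inE => /andP[uS /eqP xu]; have [_ yu] := hP u uS.
split; [by rewrite xu|by rewrite yu|move=> [|//] _].
by have := hk u uS; rewrite mul1n xu yu.
Qed.

Lemma bounded_right1 lo hi w : bounded (right_end lo hi) 1 1 w (r * (hi - lo)).
Proof.
move=> W x y S hP _ hk nF.
rewrite mulnC -[leqRHS]add0n -(@cards0 T).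
apply: (@card_cover _ _ (fun g => [set u in S | y u == g])).
  move=> u uS; right; have [h1 h2] := hP u uS.
  by exists (y u); [|rewrite inE uS /=].
move=> g gh; case: (leqP #|_| r) => // /ltnW rF; case: nF.
exists [set u in S | y u == g], (fun k => if k is 0 then lo else g).
split=> //; first by apply/subsetP => u; rewrite inE => /andP[].
move=> u; rewrite inE => /andP[uS /eqP yu]; have [xu _] := hP u uS.
split; [by rewrite xu|by rewrite yu|move=> [|//] _].
by have := hk u uS; rewrite mul1n xu yu.
Qed.

(** All windows coincide, so their number is at most [r]; the factor [hi - lo] gives the bound the
    same form as for the end windows. *)
Lemma bounded_whole1 lo hi w : bounded (whole lo hi) 1 1 w (r * (hi - lo)).
Proof.
move=> W x y S hP _ hk nF.
have [->|[u0 u0S]] := set_0Vmem S; first by rewrite cards0.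
have lohi : lo < hi.
  have [xl yh] := hP _ u0S; have := hk _ u0S.
  by rewrite mul1n => /(leq_trans B0)/wt_gt0; rewrite xl yh.
apply: (@leq_trans r); last by rewrite leq_pmulr // subn_gt0.
case: (leqP #|S| r) => // /ltnW rF; case: nF.
exists S, (fun k => if k is 0 then lo else hi); split=> // u uS.
have [xl yh] := hP u uS.
split; [by rewrite xl|by rewrite yh|move=> [|//] _].
by have := hk u uS; rewrite mul1n xl yh.
Qed.

End Formations.

(** * Splitting the rows into groups *)

Section Splitting.
Local Open Scope nat_scope.
Variables (T : finType) (B r : nat).
Implicit Types (W : T -> nat -> nat) (S : {set T}).

(* R consists of the columns that survive the contraction of the groups
   [g t, (g + 1) t) to single rows: their windows become [a, b). *)
Lemma split_groups t q k L K w N lo hi W x y S : 0 < t ->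
  (forall g, @bounded T B r (inner (g * t) (g.+1 * t)) q k w N) ->
  (forall g, @bounded T B r (left_end (g * t) (g.+1 * t)) q L w N) ->
  (forall g, @bounded T B r (right_end (g * t) (g.+1 * t)) q L w N) ->
  (forall g, @bounded T B r (whole (g * t) (g.+1 * t)) q K w N) ->
  (forall u, u \in S -> inner lo hi (x u) (y u)) ->
  (forall u i, u \in S -> x u <= i < y u -> W u i <= w * B) ->
  (forall u, u \in S -> k * B <= wt (W u) (x u) (y u)) ->
  ~ formation B r W x y S q ->
  exists R : {set T}, [/\ R \subset S,
    #|S| <= #|R| + ((hi.-1 %/ t).+1 - lo %/ t) * (4 * N) &
    forall u, u \in R -> let a := ((x u).-1 %/ t).+1 in let b := y u %/ t in
      [/\ a <= b, forall g, a <= g < b -> wt (W u) (g * t) (g.+1 * t) <= K * B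
        & wt (W u) (x u) (y u) <= wt (W u) (a * t) (b * t) + 2 * L * B]].
Proof.
move=> t0 bI bL bR bW hP hW hk nF.
(* These are the groups of the entries just before and just after the window, so every group
   strictly in between lies inside the window. *)
pose a u := (x u).-1 %/ t; pose b u := y u %/ t.
(* The removed columns: those local to one group, and those heavy in their first, last or some
   middle group. Each class is bounded by one of the four hypotheses, whence [4 * N] per group. *)
pose Loc g := [set u in S | (a u == g) && (b u == g)].
pose Lft g := [set u in S | [&& a u == g, g < b u & L * B <= wt (W u) (x u) (g.+1 * t)]].
pose Rgt g := [set u in S | [&& b u == g, a u < g & L * B <= wt (W u) (g * t) (y u)]].
pose Mid g := [set u in S | [&& a u < g, g < b u & K * B <= wt (W u) (g * t) (g.+1 * t)]].
pose F g := Loc g :|: Lft g :|: Rgt g :|: Mid g.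
have mt i j : i <= j -> i * t <= j * t by move=> ij; rewrite leq_mul2r ij orbT.
have ax u : u \in S -> a u * t < x u <= (a u).+1 * t.
  move=> uS; have [x0 _] := hP u uS; rewrite /a.
  by have := leq_trunc_div (x u).-1 t; have := ltn_ceil (x u).-1 t0; lia.
have yb u : b u * t <= y u < (b u).+1 * t.
  by rewrite /b leq_trunc_div ltn_ceil.
have ab u : u \in S -> a u <= b u.
  by move=> uS; have [x0 xy] := hP u uS; rewrite /a /b leq_div2r //; lia.
have alo u : u \in S -> lo %/ t <= a u.
  by move=> uS; have [x0 xy] := hP u uS; rewrite /a leq_div2r //; lia.
have bhi u : u \in S -> b u <= hi.-1 %/ t.
  by move=> uS; have [x0 xy] := hP u uS; rewrite /b leq_div2r //; lia.
pose R := [set u in S | [forall g : 'I_(hi.-1 %/ t).+1, u \notin F g]].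
have RS : R \subset S by apply/subsetP => u; rewrite inE => /andP[].
have RF u g : u \in R -> g <= hi.-1 %/ t -> u \notin F g.
  rewrite inE => /andP[_ /forallP Rg] gh.
  by have := Rg (Ordinal (gh : g < (hi.-1 %/ t).+1)).
exists R; split=> //.
- apply: (@card_cover T _ _ F).
    move=> u uS; have [uR|] := boolP (u \in R); first by left.
    rewrite inE uS /= => /forallPn[[g /= gh]]; rewrite negbK => uF.
    right; exists g => //.
    rewrite gh andbT; apply: leq_trans (alo u uS) _.
    by move: uF; rewrite !inE uS /=; lia.
  move=> g gh; rewrite !mulSn mul0n addn0 !addnA.
  apply: leq_trans (leq_card_setU _ _) _; apply: leq_add.
    apply: leq_trans (leq_card_setU _ _) _; apply: leq_add.
      apply: leq_trans (leq_card_setU _ _) _; apply: leq_add.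
        apply: (bI g W x y (Loc g)).
        - move=> u; rewrite inE => /andP[uS /andP[/eqP ag /eqP bg]].
          have := ax u uS; have := yb u; rewrite ag bg => ? ?.
          by have [_ ?] := hP u uS; split; lia.
        - by move=> u i; rewrite inE => /andP[uS _]; apply: hW.
        - by move=> u; rewrite inE => /andP[uS _]; apply: hk.
        by move=> h; apply: nF; apply: formation_subset h; apply/subsetP => u; rewrite inE => /andP[].
      apply: (bL g W x (fun=> g.+1 * t) (Lft g)).
      - move=> u; rewrite inE => /andP[uS /and3P[/eqP ag _ _]].
        by have := ax u uS; rewrite ag.
      - move=> u i; rewrite inE => /andP[uS /and3P[/eqP ag gb _]] hi'.
        by apply: hW => //; have := yb u; have := mt _ _ gb; lia.
      - by move=> u; rewrite inE => /andP[uS /and3P[]].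
      move=> [U [c [US rU hU]]]; apply: nF; exists U, c; split=> //.
        by apply: subset_trans US _; apply/subsetP => u; rewrite inE => /andP[].
      move=> u uU; have [h1 h2 h3] := hU u uU; split=> //.
      have := subsetP US u uU; rewrite inE => /andP[uS /and3P[/eqP ag gb _]].
      by have := yb u; have := mt _ _ gb; lia.
    apply: (bR g W (fun=> g * t) y (Rgt g)).
    - move=> u; rewrite inE => /andP[uS /and3P[/eqP bg _ _]].
      by have := yb u; rewrite bg.
    - move=> u i; rewrite inE => /andP[uS /and3P[/eqP bg ga _]] hi'.
      by apply: hW => //; have := ax u uS; have := mt _ _ ga; lia.
    - by move=> u; rewrite inE => /andP[uS /and3P[]].
    move=> [U [c [US rU hU]]]; apply: nF; exists U, c; split=> //.
      by apply: subset_trans US _; apply/subsetP => u; rewrite inE => /andP[].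
    move=> u uU; have [h1 h2 h3] := hU u uU; split=> //.
    have := subsetP US u uU; rewrite inE => /andP[uS /and3P[/eqP bg ga _]].
    by have := ax u uS; have := mt _ _ ga; lia.
  apply: (bW g W (fun=> g * t) (fun=> g.+1 * t) (Mid g)).
  - by [].
  - move=> u i; rewrite inE => /andP[uS /and3P[ga gb _]] hi'.
    by apply: hW => //; have := ax u uS; have := yb u; have := mt _ _ ga; have := mt _ _ gb; lia.
  - by move=> u; rewrite inE => /andP[uS /and3P[]].
  move=> [U [c [US rU hU]]]; apply: nF; exists U, c; split=> //.
    by apply: subset_trans US _; apply/subsetP => u; rewrite inE => /andP[].
  move=> u uU; have [h1 h2 h3] := hU u uU.
  have := subsetP US u uU; rewrite inE => /andP[uS /and3P[ga gb _]].
  by split=> //; have := ax u uS; have := yb u; have := mt _ _ ga; have := mt _ _ gb; lia.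
move=> u uR; have uS := subsetP RS u uR; rewrite /= -/(a u) -/(b u).
have [aB bB] := (alo u uS, bhi u uS).
have nab : a u < b u.
  have := RF u (a u) uR (leq_trans (ab u uS) bB).
  by rewrite !inE uS eqxx /=; have := ab u uS; lia.
have nL : wt (W u) (x u) ((a u).+1 * t) <= L * B.
  by have := RF u (a u) uR (leq_trans (ab u uS) bB); rewrite !inE uS eqxx /= nab; lia.
have nR : wt (W u) (b u * t) (y u) <= L * B.
  by have := RF u (b u) uR bB; rewrite !inE uS eqxx /= nab; lia.
split=> //.
  move=> g /andP[ag gb]; have := RF u g uR (leq_trans (ltnW gb) bB).
  by rewrite !inE uS /= ag gb /=; lia.
(* Besides the full groups, the window only has its parts in the two end groups, each of weight at
   most [L * B] by [nL] and [nR]. *)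
have m1 := mt _ _ nab; have m2 := ax u uS; have m3 := yb u.
rewrite (@wt_cat _ (x u) ((a u).+1 * t)); [|by lia|by lia].
by rewrite (@wt_cat _ _ (b u * t) (y u)); lia.
Qed.

End Splitting.

(** * Levels of the inverse Ackermann hierarchy *)

Section Levels.
Local Open Scope nat_scope.

(* With p + 1 fat intervals and entries at most w B, a column is heavy at level d
   when its weight is at least B times [inner_cost], [end_cost p] or
   [whole_cost p], according to the kind of window.  At level 1 a column meets
   at most 16 ^ 2 groups between its end groups, whence the factor 258. *)
Fixpoint inner_cost (L K : nat -> nat -> nat) (d w : nat) : nat :=
  if d is d'.+1 then 2 * L d w + 258 * K d w + inner_cost L K d' (K d w) else 0.

(** Trimming one interval costs [w + 1]: it turns an end window into an inner one and a whole window
    into an end one. Both costs are built together because [inner_cost] takes both. *)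
Fixpoint costs (p : nat) : (nat -> nat -> nat) * (nat -> nat -> nat) :=
  if p is p'.+1 then
    let: (L, K) := costs p' in
    (fun d w => inner_cost L K d w + w + 1, fun d w => L d w + w + 1)
  else (fun _ _ => 1, fun _ _ => 1).

Definition end_cost p := (costs p).1.
Definition whole_cost p := (costs p).2.

Lemma end_costS p d w :
  end_cost p.+1 d w = inner_cost (end_cost p) (whole_cost p) d w + w + 1.
Proof. by rewrite /end_cost /whole_cost /=; case: (costs p). Qed.

Lemma whole_costS p d w : whole_cost p.+1 d w = end_cost p d w + w + 1.
Proof. by rewrite /end_cost /whole_cost /=; case: (costs p). Qed.

Lemma whole_cost_gt0 p d w : 0 < whole_cost p d w.
Proof. by case: p => [//|p]; rewrite whole_costS addn1. Qed.

Lemma invack_0 d : 0 < d -> invack d 0 = 0.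
Proof. by case: d => [|[]]. Qed.

(** Rounding outwards to multiples of [t] adds less than [2 * t] rows, and [t < hi - lo]. *)
Lemma groups_size lo hi t : 0 < t -> t < hi - lo ->
  ((hi.-1 %/ t).+1 - lo %/ t) * t <= 3 * (hi - lo).
Proof.
move=> t0 tm; have h1 := leq_trunc_div hi.-1 t; have h2 := ltn_ceil lo t0.
rewrite mulnBl mulSn; lia.
Qed.

(** Contraction does not increase the number of rows, so the row bound [16 ^ x] carries over to the
    contracted columns. *)
Lemma groups_count lo hi t : 0 < t -> lo < hi ->
  (hi.-1 %/ t).+1 - lo %/ t <= hi - lo.
Proof.
move=> t0 lh; have -> : hi.-1 = lo + (hi.-1 - lo) by lia.
have : (lo + (hi.-1 - lo)) %/ t <= (hi.-1 - lo) + lo %/ t.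
  rewrite -divnMDl //; apply: leq_div2r.
  by rewrite addnC leq_add2r leq_pmulr.
lia.
Qed.

Variables (T : finType) (B r : nat).
Hypothesis B0 : 0 < B.

(* The row bound is exponential in x because the count at level d - 1 loses a
   factor 16 ^ j with j = alpha_(d-1)(x), which groups of 16 ^ j rows absorb. *)
Definition at_level (P : nat -> nat -> nat -> nat -> Prop) q (k : nat -> nat -> nat) :=
  forall d w j x lo hi, 0 < d -> invack d x <= j -> hi - lo <= 16 ^ x ->
    @bounded T B r (P lo hi) q (k d w) w (r * (16 ^ j * (hi - lo))).

Section Inner.
Variables (q : nat) (L K : nat -> nat -> nat).
Hypotheses (lvlL : at_level left_end q L) (lvlR : at_level right_end q L)
  (lvlK : at_level whole q K) (K0 : forall d w, 0 < K d w).

(** Among at most 16 rows, a weight of [258 * K d w * B] forces a single row of weight at least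
    [K d w * B]. Columns are classified by such a row, which is a whole window for them. *)
Lemma inner_small d w lo hi : 0 < d -> hi - lo <= 16 ->
  @bounded T B r (inner lo hi) q (inner_cost L K d w) w (r * (hi - lo)).
Proof.
move=> d0 m16 W x y S hP hW hk nF.
rewrite mulnC -[leqRHS]add0n -(@cards0 T).
pose F g := [set u in S | (x u <= g < y u) && (K d w * B <= W u g)].
apply: (@card_cover _ _ _ F).
  move=> u uS; right; have [x0 xy] := hP u uS.
  have [/existsP[g /andP[gxy Kg]]|] := boolP [exists g : 'I_hi,
      (x u <= g < y u) && (K d w * B <= W u g)].
    by exists g; [lia|rewrite inE uS gxy].
  rewrite negb_exists => /forallP noK.
  have KB : 0 < K d w * B by rewrite muln_gt0 K0.
  have := @wt_leM (W u) (x u) (y u) (K d w * B).-1.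
  have hlt i : x u <= i < y u -> W u i <= (K d w * B).-1.
    move=> hi'; have ih : i < hi by lia.
    by have := noK (Ordinal ih); rewrite /= hi' /=; lia.
  move/(_ hlt) => hle; have := hk u uS.
  have : (y u - x u) * (K d w * B).-1 <= 16 * (K d w * B) by apply: leq_mul; lia.
  have : 258 * (K d w * B) <= inner_cost L K d w * B.
    by case: (d) d0 => // d' _ /=; rewrite mulnA leq_mul2r; lia.
  by lia.
move=> g gh.
(* One row is [16 ^ 0] rows and [invack d 0 = 0], so [x = j = 0] is allowed and the bound is [r]
   columns per row. *)
have := @lvlK d w 0 0 g g.+1 d0; rewrite invack_0 // subSnn !expn0 !muln1 => /(_ isT isT) HK.
apply: (HK W (fun=> g) (fun=> g.+1) (F g)).
- by [].
- by move=> u i; rewrite inE => /and3P[uS gxy _] gi; apply: hW => //; lia.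
- by move=> u; rewrite inE => /and3P[uS gxy]; rewrite /wt big_nat1.
move=> [U [c [US rU hU]]]; apply: nF; exists U, c; split=> //.
  by apply: subset_trans US _; apply/subsetP => u; rewrite inE => /andP[].
move=> u uU; have [h1 h2 h3] := hU u uU.
by have := subsetP US u uU; rewrite inE => /and3P[uS gxy _]; split=> //; lia.
Qed.

(** The constant 12 is made up of the four classes of removed columns and the factor 3 of
    [groups_size]. *)
Lemma split_level d w j' y' lo hi W x y (S : {set T}) :
  0 < d -> invack d y' <= j' -> 16 ^ y' < hi - lo ->
  (forall lo hi, hi - lo <= 16 ^ y' -> @bounded T B r (inner lo hi) q
     (inner_cost L K d w) w (r * (16 ^ j' * (hi - lo)))) ->
  (forall u, u \in S -> inner lo hi (x u) (y u)) ->
  (forall u i, u \in S -> x u <= i < y u -> W u i <= w * B) ->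
  (forall u, u \in S -> inner_cost L K d w * B <= wt (W u) (x u) (y u)) ->
  ~ formation B r W x y S q ->
  let t := 16 ^ y' in
  exists R : {set T}, [/\ R \subset S,
    #|S| <= #|R| + 12 * (r * (16 ^ j' * (hi - lo))) &
    forall u, u \in R -> let a := ((x u).-1 %/ t).+1 in let b := y u %/ t in
      [/\ a <= b, forall g, a <= g < b -> wt (W u) (g * t) (g.+1 * t) <= K d w * B
        & inner_cost L K d w * B <= wt (W u) (a * t) (b * t) + 2 * L d w * B]].
Proof.
move=> d0 yj tm IH hP hW hk nF t.
have t0 : 0 < t by rewrite expn_gt0.
have gt g : g.+1 * t - g * t = t by rewrite mulSn addnK.
have gt' g : g.+1 * t - g * t <= 16 ^ y' by rewrite gt.
have := @split_groups T B r t q (inner_cost L K d w) (L d w) (K d w) w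
  (r * (16 ^ j' * t)) lo hi W x y S t0.
case=> //.
- by move=> g; have := IH (g * t) (g.+1 * t) (gt' g); rewrite gt.
- by move=> g; have := @lvlL d w j' y' (g * t) (g.+1 * t) d0 yj (gt' g); rewrite gt.
- by move=> g; have := @lvlR d w j' y' (g * t) (g.+1 * t) d0 yj (gt' g); rewrite gt.
- by move=> g; have := @lvlK d w j' y' (g * t) (g.+1 * t) d0 yj (gt' g); rewrite gt.
move=> R [RS SR hR]; exists R; split=> //.
  apply: leq_trans SR _; rewrite leq_add2l.
  have := groups_size t0 tm; set b := _ - _ => bt.
  have -> : b * (4 * (r * (16 ^ j' * t))) = 4 * (r * 16 ^ j') * (b * t) by lia.
  have -> : 12 * (r * (16 ^ j' * (hi - lo))) = 4 * (r * 16 ^ j') * (3 * (hi - lo)) by lia.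
  by rewrite leq_mul2l bt orbT.
move=> u uR /=; have [h1 h2 h3] := hR u uR; split=> //.
by apply: leq_trans h3; apply: hk; apply: subsetP uR.
Qed.

(** Induction on [d] and, within a level, on [j]. Above level 1 the removed columns contribute 12
    and the contracted survivors at most 3 times [r * (16 ^ j * (hi - lo))], which fits into the
    factor 16 gained by passing to [j + 1]. *)
Lemma inner_at_level : at_level inner q (inner_cost L K).
Proof.
move=> d w; elim: d w => // d IHd w j.
elim: j => [|j IHj] x lo hi _ xj mx W X Y S hP hW hk nF.
  have x1 : x <= 1.
    by case: d xj {IHd hk} => [|d]; [rewrite /=; lia|case: x mx => [|[]]].
  rewrite expn0 mul1n.
  apply: (@inner_small d.+1 w lo hi isT _ W X Y S) => //.
  by apply: leq_trans mx _; rewrite -{2}[16]expn1 leq_exp2l.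
have [-> |[u0 u0S]] := set_0Vmem S; first by rewrite cards0.
have lohi : lo < hi by have [] := hP u0 u0S; lia.
case: (leqP x 1) => x2.
  apply: (@leq_trans (r * (hi - lo))).
    apply: (@inner_small d.+1 w lo hi isT _ W X Y S) => //.
    by apply: leq_trans mx _; rewrite -{2}[16]expn1 leq_exp2l.
  by rewrite leq_mul2l leq_pmull ?orbT // expn_gt0.
have mono y : hi - lo <= 16 ^ y -> invack d.+1 y <= j ->
    #|S| <= r * (16 ^ j.+1 * (hi - lo)).
  move=> my yj; apply: leq_trans (IHj y lo hi isT yj my W X Y S hP hW hk nF) _.
  by rewrite leq_mul2l leq_mul2r leq_exp2l // leqnSn !orbT.
have expj : 16 ^ j.+1 * (hi - lo) = 16 * (16 ^ j * (hi - lo)) by rewrite expnS mulnA.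
case: d IHd IHj xj hk mono => [|d] IHd IHj xj hk mono.
  (* At level 1, groups of [16 ^ (2 * j)] rows and [x <= 2 * (j + 1)] leave at most 256 full groups
     in a window. A survivor would weigh at most [2 * L + 256 * K] times [B], less than its cost, so
     there is none. *)
  have y'j : invack 1 j.*2 <= j by rewrite /=; lia.
  case: (leqP (hi - lo) (16 ^ j.*2)) => [m_t|t_m]; first exact: mono m_t y'j.
  have [|R [RS SR hR]] := @split_level 1 w j j.*2 lo hi W X Y S isT y'j t_m _ hP hW hk nF.
    by move=> lo' hi'; apply: IHj.
  suff R0 : R = set0.
    move: SR; rewrite R0 cards0 expj => /leq_trans; apply.
    by rewrite mulnCA leq_mul2l leq_mul2r !orbT.
  apply/setP => u; rewrite inE; apply/negP => uR.
  have [/= ab gK kle] := hR u uR.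
  have uS := subsetP RS u uR; have [x0 xy] := hP u uS.
  set t := 16 ^ j.*2 in t_m ab gK kle.
  have t0 : 0 < t by rewrite expn_gt0.
  have wab : wt (W u) (((X u).-1 %/ t).+1 * t) (Y u %/ t * t) <= 256 * (K 1 w * B).
    rewrite -wt_group; apply: leq_trans (wt_leM gK) _.
    rewrite leq_mul2r; apply/orP; right.
    rewrite -(leq_pmul2r t0) mulnBl.
    have h1 := leq_trunc_div (Y u) t; have h2 := ltn_ceil (X u).-1 t0.
    have : 16 ^ x <= 16 ^ j.+1.*2 by rewrite leq_exp2l //; move: xj => /=; lia.
    by rewrite doubleS !expnS mulnA -/t; lia.
  have KB : 0 < K 1 w * B by rewrite muln_gt0 K0.
  move: kle wab KB; rewrite /= addn0 mulnDl -!mulnA; clear.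
  by move: (wt _ _ _) (L 1 w * B) (K 1 w * B); lia.
(* One application of [invack d.+1] lowers [invack d.+2] by 1. Level [d.+1] with [j = y] loses the
   factor [16 ^ y], which is exactly the group size. *)
pose y := invack d.+1 x.
have yj : invack d.+2 y <= j.
  by move: xj; rewrite invack_rec //= add1n ltnS.
case: (leqP (hi - lo) (16 ^ y)) => [m_t|t_m]; first exact: mono m_t yj.
have [|R [RS SR hR]] := @split_level d.+2 w j y lo hi W X Y S isT yj t_m _ hP hW hk nF.
  by move=> lo' hi'; apply: IHj.
set t := 16 ^ y in t_m hR.
have t0 : 0 < t by rewrite expn_gt0.
set lo' := lo %/ t; set hi' := (hi.-1 %/ t).+1.
pose X' u := ((X u).-1 %/ t).+1; pose Y' u := Y u %/ t.
have Rb : #|R| <= r * (16 ^ y * (hi' - lo')).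
  apply: (IHd (K d.+2 w) y x lo' hi' isT (leqnn _) _
    (fun u g => wt (W u) (g * t) (g.+1 * t)) X' Y' R).
  - by apply: leq_trans mx; apply: groups_count.
  - move=> u uR; have [/= ab _ _] := hR u uR.
    have [x0 xy] := hP u (subsetP RS u uR).
    by rewrite /inner /X' /Y' /lo' /hi' !ltnS !leq_div2r //; try lia; rewrite ab.
  - by move=> u g uR; have [_ h _] := hR u uR; apply: h.
  - move=> u uR; have [_ _] := hR u uR; rewrite /= -/(inner_cost _ _ _ _) wt_group.
    by rewrite /X' /Y' !mulnDl; lia.
  move=> [U [c [US rU hU]]]; apply: nF.
  (* Multiplying the cut points by [t] turns a formation of contracted rows into one of the original
     rows. *)
  exists U, (fun i => c i * t); split=> //; first exact: subset_trans US RS.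
  move=> u uU; have [h1 h2 h3] := hU u uU.
  have k1 := ltn_ceil (X u).-1 t0; have k2 := leq_trunc_div (Y u) t.
  have m1 : X' u * t <= c 0 * t by rewrite leq_mul2r h1 orbT.
  have m2 : c q * t <= Y' u * t by rewrite leq_mul2r h2 orbT.
  rewrite /X' /Y' in m1 m2; split; [lia|lia|].
  by move=> i iq; rewrite -wt_group; apply: h3.
have := groups_size t0 t_m; rewrite -/lo' -/hi' => bt.
have Rm : #|R| <= 3 * (r * (16 ^ j * (hi - lo))).
  apply: leq_trans Rb _; rewrite -/t [t * _]mulnC [3 * _]mulnCA leq_mul2l.
  apply/orP; right; apply: leq_trans bt _.
  by rewrite leq_mul2l leq_pmull // expn_gt0.
by rewrite expj mulnCA; apply: leq_trans SR _; lia.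
Qed.

End Inner.

(** Bounds for inner windows with [p.+1] intervals yield those for end windows with one more
    interval, by trimming at the fixed end. Trimming a whole window on the right leaves a window of
    kind [right_end]. *)
Lemma costs_at_level p :
  [/\ at_level left_end p.+1 (end_cost p), at_level right_end p.+1 (end_cost p)
    & at_level whole p.+1 (whole_cost p)].
Proof.
elim: p => [|p [HL HR HK]].
  have leN j n : r * n <= r * (16 ^ j * n).
    by rewrite leq_mul2l leq_pmull ?orbT // expn_gt0.
  split=> d w j x lo hi _ _ _; apply: bounded_leq (leN j _) _.
  - exact: bounded_left1.
  - exact: bounded_right1.
  - exact: bounded_whole1.
have HI := inner_at_level HL HR HK (whole_cost_gt0 p).
split=> d w j x lo hi d0 xj mx.
- rewrite end_costS; apply: (bounded_trim_right B0 (hi := hi)) (HI d w j x lo hi d0 xj mx).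
    by rewrite /left_end /inner; lia.
  by move=> ? ? [].
- rewrite end_costS; apply: (bounded_trim_left B0 (lo := lo)) (HI d w j x lo hi d0 xj mx).
    by rewrite /right_end /inner; lia.
  by move=> ? ? [].
- rewrite whole_costS; apply: (bounded_trim_right B0 (hi := hi)) (HR d w j x lo hi d0 xj mx).
    by rewrite /right_end /whole; lia.
  by move=> ? ? [].
Qed.

End Levels.

(** * Cutting columns into pieces *)

Section Pieces.
Local Open Scope nat_scope.

Lemma wt_gt0_ex f x y : 0 < wt f x y -> exists2 i, x <= i < y & 0 < f i.
Proof.
move=> h; apply: contrapT => /forall2NP H.
suff : wt f x y <= (y - x) * 0 by rewrite muln0; lia.
by apply: wt_leM => i xiy; have [//|/negP] := H i; lia.
Qed.

(** Piece [l] consists of the rows whose prefix weight lies in the [l]-th block of length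
    [(k + 1) * B]. Entering the block overshoots by at most one entry, hence by [B], which the extra
    1 pays for. *)
Lemma wt_piece f m B k l : 0 < B -> (forall i, i < m -> f i <= B) ->
  l.+1 * ((k + 1) * B) <= wt f 0 m ->
  k * B <= wt (fun i => if wt f 0 i %/ ((k + 1) * B) == l then f i else 0) 0 m.
Proof.
move=> B0 fB hl; set k' := (k + 1) * B in hl *.
have k'0 : 0 < k' by rewrite muln_gt0 addn1.
have ex1 : exists i, l.+1 * k' <= wt f 0 i by exists m.
have ex0 : exists i, l * k' <= wt f 0 i.
  by exists m; apply: leq_trans hl; rewrite leq_mul2r leqnSn orbT.
pose z1 := ex_minn ex1; pose z0 := ex_minn ex0.
have [h1 m1] : l.+1 * k' <= wt f 0 z1 /\ forall i, i < z1 -> wt f 0 i < l.+1 * k'.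
  rewrite /z1; case: ex_minnP => z hz mz; split=> // i iz.
  by rewrite ltnNge; apply/negP => /mz; lia.
have [h0 m0] : l * k' <= wt f 0 z0 /\ forall i, i < z0 -> wt f 0 i < l * k'.
  rewrite /z0; case: ex_minnP => z hz mz; split=> // i iz.
  by rewrite ltnNge; apply/negP => /mz; lia.
have z1m : z1 <= m by rewrite /z1; case: ex_minnP => z _; apply.
have z01 : z0 <= z1.
  by rewrite leqNgt; apply/negP => /m0; rewrite ltnNge (leq_trans _ h1) // leq_mul2r leqnSn orbT.
have p0 : wt f 0 z0 <= l * k' + B.
  case: z0 m0 z01 {h0} => [|z] m0 z01; first by rewrite wt_geq.
  have fz : f z <= B by apply: fB; lia.
  have := m0 z (ltnSn z); rewrite (@wt_cat f 0 z z.+1) // {3}/wt big_nat1; lia.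
apply: (@leq_trans (wt f z0 z1)).
  have := @wt_cat f 0 z0 z1 isT z01; move: h1 p0; rewrite /k' mulSn mulnDl mul1n; lia.
apply: leq_trans (wt_sub _ (leq0n z0) z1m).
rewrite /wt big_nat [leqRHS]big_nat; apply: leq_sum => i /andP[zi iz].
rewrite ifT //; apply/eqP/anti_leq; rewrite leq_divRL // (leq_trans h0) ?andbT; last first.
  exact: wt_sub.
by rewrite -ltnS ltn_divLR //; apply: m1.
Qed.

(* Each column is cut into consecutive pieces of weight about (k + 1) B, treated as
   separate columns; two pieces of one column cannot lie in the same formation,
   since it has at least two intervals. *)
Lemma total_weight (T : finType) (B r p d j x m : nat) (W : T -> nat -> nat) :
  0 < B -> 0 < d -> invack d x <= j -> m <= 16 ^ x ->
  (forall u i, i < m -> W u i <= B) ->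
  ~ formation B r W (fun=> 0) (fun=> m) setT p.+2 ->
  \sum_u wt (W u) 0 m <= (whole_cost p.+1 d 1 + 1) * B * (#|T| + r * (16 ^ j * m)).
Proof.
move=> B0 d0 xj mx WB nF.
set k := whole_cost p.+1 d 1; set k' := (k + 1) * B.
have k'0 : 0 < k' by rewrite muln_gt0 addn1.
have totB u : wt (W u) 0 m <= m * B.
  by rewrite -{2}[m]subn0; apply: wt_leM => i /andP[_]; apply: WB.
(* A column weighs at most [m * B], so this many indices suffice for its pieces. *)
pose W' (v : T * 'I_(m * B)) i := if wt (W v.1) 0 i %/ k' == v.2 then W v.1 i else 0.
pose S := [set v : T * 'I_(m * B) | v.2.+1 * k' <= wt (W v.1) 0 m].
have W'W v i : W' v i <= W v.1 i by rewrite /W'; case: ifP.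
have cS : \sum_u wt (W u) 0 m %/ k' <= #|S|.
  have -> : #|S| = \sum_u \sum_(l < m * B) (l < wt (W u) 0 m %/ k').
    rewrite pair_big /= -sum1_card big_mkcond /=; apply: eq_bigr => -[u l] _.
    by rewrite inE /= leq_divRL //; case: ifP.
  apply: leq_sum => u _; rewrite -big_mkcond /= -(big_ord_widen _ (fun=> 1)).
    by rewrite sum1_card card_ord.
  by apply: leq_trans (totB u); apply: leq_div.
have HS : #|S| <= r * (16 ^ j * m).
  have [_ _ HK] := @costs_at_level (T * 'I_(m * B))%type B r B0 p.+1.
  have := HK d 1 j x 0 m d0 xj; rewrite subn0 => /(_ mx W' (fun=> 0) (fun=> m) S).
  apply=> //.
  - by move=> v i _ im; rewrite mul1n; apply: leq_trans (W'W v i) (WB _ _ im).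
  - move=> v; rewrite inE => hv; apply: wt_piece => // i; exact: WB.
  move=> [U [c [US rU hU]]]; apply: nF.
  exists (fst @: U), c; split; first by apply/subsetP => u; rewrite inE.
    rewrite card_in_imset // => -[u l] [u' l'] vU vU' /= uu'; subst u'.
    (* Piece [a] has a positive row in the first interval and piece [b] one in the second, hence a
       later one. Prefix weights are monotone, so [a <= b], and equality follows by symmetry. *)
    suff H (a b : 'I_(m * B)) : (u, a) \in U -> (u, b) \in U -> a <= b.
      by congr (_, _); apply/val_inj/anti_leq; rewrite !H.
    move=> aU bU; have [_ _ ha] := hU _ aU; have [_ _ hb] := hU _ bU.
    have [i /andP[c0i ic1]] := wt_gt0_ex (leq_trans B0 (ha 0 isT)).
    have [i' /andP[c1i ic2]] := wt_gt0_ex (leq_trans B0 (hb 1 isT)).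
    rewrite /W' /=; case: eqP => // <- _; case: eqP => // <- _.
    by apply: leq_div2r; apply: wt_sub => //; lia.
  move=> _ /imsetP[v vU ->]; have [h1 h2 h3] := hU v vU; split=> //.
  by move=> i iq; apply: leq_trans (h3 i iq) _; apply: leq_sum.
(* What is left of a column after its full pieces weighs less than [k']; this produces the summand
   [#|T|]. *)
apply: (@leq_trans (\sum_u (k' * (wt (W u) 0 m %/ k') + k'))).
  apply: leq_sum => u _; rewrite {1}(divn_eq (wt (W u) 0 m) k') mulnC leq_add2l.
  by apply: ltnW; rewrite ltn_mod.
rewrite big_split /= -big_distrr /= sum_nat_const addnC mulnDr [#|T| * _]mulnC.
by rewrite leq_add2l leq_mul2l (leq_trans cS HS) orbT.
Qed.

End Pieces.

(** * Back to matrices *)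

Section Matrix.
Local Open Scope nat_scope.
Variables (m n : nat) (M : 'M[bool]_(m, n)).

Definition col_ones (j : 'I_n) (a b : nat) : nat :=
  #|[set i : 'I_m | (a <= i < b) && M i j]|.

Lemma col_ones_cat j a b c : a <= b -> b <= c ->
  col_ones j a c = col_ones j a b + col_ones j b c.
Proof.
move=> ab bc; rewrite /col_ones -[RHS]cardsUI [X in _ = _ + X]eq_card0 ?addn0.
  by apply: eq_card => i; rewrite !inE; lia.
by move=> i; rewrite !inE; lia.
Qed.

Lemma col_ones_wt (f : nat -> nat) j a b :
  (forall k, f k <= f k.+1) ->
  wt (fun k => col_ones j (f k) (f k.+1)) a b = if a <= b then col_ones j (f a) (f b) else 0.
Proof.
move=> fS; case: leqP => [|/ltnW ba]; last by rewrite wt_geq.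
have fmono : {homo f : x y / x <= y} by apply: homo_leq => //; exact: leq_trans.
elim: b => [|b IH].
  rewrite leqn0 => /eqP->; rewrite wt_geq //; apply/esym/eqP.
  by rewrite cards_eq0; apply/eqP/setP => i; rewrite !inE; lia.
rewrite leq_eqVlt => /orP[/eqP->|].
  rewrite wt_geq //; apply/esym/eqP.
  by rewrite cards_eq0; apply/eqP/setP => i; rewrite !inE; lia.
rewrite ltnS => ab; rewrite (@wt_cat _ a b) // {2}/wt big_nat1 IH //.
by rewrite -col_ones_cat ?fmono.
Qed.

Lemma col_ones_le j a b : col_ones j a b <= b - a.
Proof.
case: (leqP a b) => ab; last first.
  rewrite /col_ones (_ : [set _ | _] = set0) ?cards0 //.
  by apply/setP => i; rewrite !inE; lia.
have := @col_ones_wt id j a b (fun k => leqnSn k); rewrite ab => <-.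
rewrite -[leqRHS]muln1; apply: wt_leM => i _.
apply: leq_trans (_ : #|[pred k : 'I_m | val k == i]| <= 1).
  apply: subset_leq_card; apply/subsetP => k; rewrite !inE => /andP[h _].
  by apply/eqP => /=; lia.
apply/card_le1_eqP => k l; rewrite !inE => /eqP <- /eqP kl.
exact/val_inj.
Qed.

Lemma ones_sum_col N : m <= N -> ones M = \sum_j col_ones j 0 N.
Proof.
move=> mN; transitivity (\sum_(i < m) \sum_(j < n) (M i j : nat)).
  rewrite pair_big /ones -sum1_card big_mkcond /=; apply: eq_bigr => ij _.
  by rewrite inE; case: (M _ _).
rewrite exchange_big /=; apply: eq_bigr => j _.
rewrite /col_ones -sum1_card [RHS]big_mkcond /=; apply: eq_bigr => i _.
by rewrite inE /= (leq_trans (ltn_ord i) mN); case: (M _ _).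
Qed.

(** The first [s] intervals are kept, the first extended back to row 0 and the last forward to row
    [m]. The cut points increase strictly because every interval contains a 1-entry. *)
Lemma formation_contains (B r s q : nat) : 0 < B -> 0 < m -> 0 < r -> 0 < s -> s <= q ->
  formation B r (fun j k => col_ones j (k * B) (k.+1 * B)) (fun=> 0)
    (fun=> (m.-1 %/ B).+1) setT q ->
  contains_fat_formation B r s M.
Proof.
move=> B0 m0 r0 s0 sq [U [c [_ rU hU]]].
have szr : size (take r (enum U)) == r by rewrite size_takel // -cardE.
have TU j : j \in Tuple szr -> j \in U.
  by move=> /mem_take; rewrite mem_enum.
pose c' k := if k == 0 then 0 else if s <= k then m else c k * B.
have c'B (j : 'I_n) k : j \in U -> k < s ->
    B <= #|[set i : 'I_m | (c' k <= i < c' k.+1) && M i j]|.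
  move=> jU ks; have [_ _ h] := hU j jU; have := h k (leq_trans ks sq).
  rewrite (@col_ones_wt (fun k => k * B)) => [|k']; last by rewrite leq_mul2r leqnSn orbT.
  case: ifP => _; last by lia.
  move/leq_trans; apply; apply: subset_leq_card; apply/subsetP => i; rewrite !inE.
  move=> /andP[/andP[h1 h2] ->]; rewrite andbT /c' /=; apply/andP; split.
    by rewrite (leqNgt s k) ks /=; case: ifP.
  by case: ifP => // _; exact: ltn_ord.
exists c', (Tuple szr); split.
- have /card_gt0P[u uU] : 0 < #|U| by exact: leq_trans rU.
  split=> //; first by rewrite /c' leqnn; case: s s0 {sq c'B c'}.
  move=> k ks; have := leq_trans B0 (c'B u k uU ks).
  by case/card_gt0P => i; rewrite inE; lia.
- by rewrite /= take_uniq // enum_uniq.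
- by move=> j k /TU jU; apply: c'B.
Qed.

(** [4096 = 16 ^ 3] reflects [invack d m <= 3] at [d = inv_ackermann m], the factor 2 comes from
    rounding [m / B] up, and the successor from the leftovers of the [n] columns. The summand [s]
    makes the final inequality strict and forces [s <= m]. [maxn s 2] secures the two intervals that
    separate pieces of one column. *)
Definition form_threshold (s d : nat) : nat :=
  s + (2 * 4096).+1 * (whole_cost (maxn s 2).-1 d 1 + 1).

(** Each block of [B] rows contributes an entry at most [B] to a column, so without a formation
    [total_weight] keeps the number of 1-entries below the threshold. *)
Lemma fat_formation_threshold (s B : nat) : 0 < m -> 0 < n -> 0 < s -> 0 < B ->
  form_threshold s (inv_ackermann m) * B * n <= ones M ->
  contains_fat_formation B (n * B %/ m) s M.
Proof.
move=> m0 n0 s0 B0; set d := inv_ackermann m; set N := form_threshold s d => hN.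
have [d0 md] : 0 < d /\ invack d m <= 3.
  by rewrite /d /inv_ackermann; case: ex_minnP => k /andP[].
have ones_mn : ones M <= m * n.
  rewrite (ones_sum_col (leqnn m)) mulnC.
  apply: leq_trans (_ : \sum_(j < n) m <= _); last by rewrite sum_nat_const card_ord.
  by apply: leq_sum => j _; rewrite -{2}[m]subn0 col_ones_le.
have NB : N * B <= m by rewrite -(leq_pmul2r n0) (leq_trans hN).
have sm : s <= m.
  apply: leq_trans NB; apply: leq_trans (leq_pmulr _ B0).
  by rewrite /N /form_threshold leq_addr.
have N0 : 0 < N by rewrite /N /form_threshold addn_gt0 s0.
have Bm : B <= m by apply: leq_trans NB; rewrite leq_pmull.
set r := n * B %/ m.
have [r0|r0] := posnP r.
  (* No columns are asked for, and [s <= m] permits single rows followed by one interval with all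
     the rest. *)
  rewrite r0; exists (fun k => if k < s then k else m), [tuple]; split=> //.
  split; [by rewrite s0|by rewrite ltnn|].
  by move=> k ks; rewrite ks; case: ifP => _ //; lia.
pose m' := (m.-1 %/ B).+1.
have m'B : m <= m' * B by have := ltn_ceil m.-1 B0; rewrite -/m'; lia.
have Bm' : m' * B <= 2 * m.
  by have := leq_trunc_div m.-1 B; rewrite /m' mulSn; lia.
pose p := (maxn s 2).-2; have pE : p.+2 = maxn s 2 by rewrite /p; lia.
apply: (@formation_contains B r s p.+2) => //; first by rewrite pE leq_maxl.
apply: contrapT => nF.
(* This crude bound is enough: the row exponent is taken to be [m], for which [invack d m <= 3]. *)
have mm' : m' <= 16 ^ m.
  have : m' <= m by rewrite /m' -[leqRHS](prednK m0) ltnS leq_div.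
  by move/leq_trans; apply; apply: ltnW; apply: ltn_expl.
have WB (j : 'I_n) k : k < m' -> col_ones j (k * B) (k.+1 * B) <= B.
  by move=> _; apply: leq_trans (col_ones_le _ _ _) _; rewrite mulSn addnK.
have := total_weight B0 d0 md mm' WB nF.
apply/negP; rewrite -ltnNge card_ord -/m'.
have -> : \sum_(u < n) wt (fun k => col_ones u (k * B) (k.+1 * B)) 0 m' = ones M.
  rewrite (ones_sum_col m'B); apply: eq_bigr => u _.
  rewrite (@col_ones_wt (fun k => k * B)) => [|k']; last by rewrite leq_mul2r leqnSn orbT.
  by rewrite mul0n.
have rm' : r * m' <= 2 * n.
  rewrite -(leq_pmul2r B0) -mulnA; apply: leq_trans (_ : r * (2 * m) <= _).
    by rewrite leq_mul2l Bm' orbT.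
  by have := leq_trunc_div (n * B) m; rewrite -/r; lia.
apply: leq_trans hN; rewrite /N /form_threshold -pE [p.+2.-1]/=.
set k := whole_cost _ _ _ + 1.
rewrite -!mulnA mulnDl.
apply: (@leq_ltn_trans ((2 * 4096).+1 * k * (B * n))).
  rewrite -[(2 * 4096).+1 * k]mulnC -mulnA leq_mul2l; apply/orP; right.
  rewrite [(2 * 4096).+1 * _]mulnCA leq_mul2l; apply/orP; right.
  have -> : r * (16 * (16 * (16 * m'))) = 4096 * (r * m') by lia.
  by lia.
by rewrite -subn_gt0 addnK !muln_gt0 s0 B0.
Qed.

End Matrix.

(** * The cost recursion and the cases of three to five intervals *)

Section CostBounds.
Local Open Scope nat_scope.

(** The index [p] belongs to formations with [p + 3] intervals: two trimmings lead from whole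
    windows to inner ones with [p + 1]. *)
Definition mid_cost p := inner_cost (end_cost p) (whole_cost p).

Lemma whole_costSS p d w : whole_cost p.+2 d w = mid_cost p d w + 2 * w.+1.
Proof. by rewrite whole_costS end_costS -/(mid_cost p); lia. Qed.

(** The last term drives the growth: at each level the entry bound [w] is replaced by [mid_cost p],
    two indices lower, plus [2 * w.+1]. *)
Lemma mid_costSS p d w : mid_cost p.+2 d.+1 w =
  2 * (mid_cost p.+1 d.+1 w + w.+1) + 258 * whole_cost p.+2 d.+1 w
  + mid_cost p.+2 d (whole_cost p.+2 d.+1 w).
Proof. by rewrite {1}/mid_cost /= end_costS -/(mid_cost p.+1) addn1 -addnS. Qed.

Lemma mid_cost0 d w : mid_cost 0 d w = 260 * d.
Proof.
elim: d w => // d IH w.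
rewrite (_ : mid_cost 0 d.+1 w = 260 + mid_cost 0 d 1) //.
by rewrite IH; lia.
Qed.

(** Here each contraction raises the entry bound only from [w] to [w + 2], so each of the [d] levels
    costs [O(w + d)]. *)
Lemma mid_cost1 d w : mid_cost 1 d w <= 600 * d * (w + 2 * d).
Proof.
elim: d w => // d IH w; rewrite {1}/mid_cost /= -/(mid_cost 1) end_costS whole_costS.
rewrite -/(mid_cost 0) mid_cost0; apply: leq_trans (leq_add (leqnn _) (IH _)) _.
by rewrite (_ : end_cost 0 d.+1 w = 1) //; nia.
Qed.

(** The quantity [w + 262 * d] at most doubles per level. The term added on the left strengthens the
    induction: [f(d) = 4000 * 2 ^ d - 2000 * (d + 2)] solves [f(d + 1) = 2 * f(d) + 2000 * (d + 1)]
    with [f(0) = 0]. *)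
Lemma mid_cost2 d w :
  mid_cost 2 d w + 2000 * (d + 2) * (w + 262 * d) <= 4000 * 2 ^ d * (w + 262 * d).
Proof.
elim: d w => [|d IH] w; first by rewrite /mid_cost /=; lia.
rewrite mid_costSS whole_costSS mid_cost0.
set K := 260 * d.+1 + 2 * w.+1.
have h1 := mid_cost1 d.+1 w.
have h2 := IH K.
have K2 : K + 262 * d <= 2 * (w + 262 * d.+1) by rewrite /K; lia.
set Y := w + 262 * d.+1 in K2 *.
have h3 : (4000 * 2 ^ d - 2000 * (d + 2)) * (K + 262 * d) <=
    (4000 * 2 ^ d - 2000 * (d + 2)) * (2 * Y) by rewrite leq_mul2l K2 orbT.
have pow : 2000 * (d + 2) <= 4000 * 2 ^ d by have := ltn_expl d (isT : 1 < 2); lia.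
rewrite !mulnBl in h3.
have pY : 2000 * (d + 2) * (K + 262 * d) <= 4000 * 2 ^ d * (K + 262 * d).
  by rewrite leq_mul2r pow orbT.
have pY' : 2000 * (d + 2) * (2 * Y) <= 4000 * 2 ^ d * (2 * Y).
  by rewrite leq_mul2r pow orbT.
have : 2 * (mid_cost 1 d.+1 w + w.+1) + 258 * K <= 2000 * d.+1 * Y.
  by rewrite /K /Y; nia.
have -> : 4000 * 2 ^ d.+1 * Y = 4000 * 2 ^ d * (2 * Y) by rewrite expnS; lia.
by lia.
Qed.

End CostBounds.

(** * Growth of the costs *)

From mathcomp Require Import all_classical all_reals all_analysis.
From mathcomp Require Import ring lra.
Import Order.TTheory GRing.Theory Num.Theory.
Import numFieldNormedType.Exports.
Local Open Scope ring_scope.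
Local Open Scope classical_set_scope.

Section RealBounds.
Variable R : realType.
Implicit Types (E : nat -> R) (d w p t : nat).

Lemma powR2D (x y : R) : 2 `^ (x + y) = 2 `^ x * 2 `^ y.
Proof. by rewrite powRD // pnatr_eq0 implybT. Qed.

Lemma ler_powR2 (x y : R) : x <= y -> 2 `^ x <= 2 `^ y.
Proof. by move=> xy; rewrite ler_powR // ler1n. Qed.

Lemma powR2_ge1 (x : R) : 0 <= x -> 1 <= 2 `^ x.
Proof. by move=> /ler_powR2; rewrite powRr0. Qed.

Lemma powR2_nat (k : nat) : 2 `^ (k%:R) = 2 ^+ k :> R.
Proof. by rewrite powR_mulrn. Qed.

Lemma ln2_gt0 : 0 < ln 2 :> R.
Proof. by rewrite ln_gt0 // ltr1n. Qed.

Lemma powR2_log2 (x : R) : 0 < x -> 2 `^ log2 x = x.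
Proof.
move=> x0; rewrite /powR pnatr_eq0 /= /log2 divfK ?lnK ?posrE //.
by rewrite gt_eqF // ln2_gt0.
Qed.

Lemma log2_ge0 (n : nat) : 0 <= log2 (n%:R : R).
Proof.
case: n => [|n]; first by rewrite /log2 ln0 ?mul0r.
by rewrite divr_ge0 ?(ltW ln2_gt0) // ln_ge0 // ler1n.
Qed.

Lemma log2_mono (m n : nat) : (0 < m)%N -> (m <= n)%N -> log2 (m%:R : R) <= log2 n%:R.
Proof.
move=> m0 mn; rewrite ler_pM2r ?invr_gt0 ?ln2_gt0 //.
by rewrite ler_ln ?posrE ?ltr0n ?ler_nat // (leq_trans m0).
Qed.

Lemma log2_le (n : nat) : log2 (n%:R : R) <= n%:R.
Proof.
case: n => [|n]; first by rewrite /log2 ln0 ?mul0r.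
rewrite ler_pdivrMr ?ln2_gt0 // mulr_natl -lnXn // ler_ln ?posrE ?ltr0n ?exprn_gt0 //.
by rewrite -natrX ler_nat ltnW // ltn_expl.
Qed.

Definition mid_bound p E := forall d w,
  (mid_cost p d.+1 w)%:R <= 2 `^ E d.+1 * (w + d.+1)%:R.

(* The factor w + d.+1 in [mid_bound] survives the recursion because there the new
   entry bound is itself of the form 2 `^ _ * (w + d.+1). *)
Lemma mid_bound_step p (D A G : nat -> R) :
  mid_bound p D -> mid_bound p.+1 A ->
  (forall d, 0 <= D d.+1) -> (forall d, 0 <= A d.+1) ->
  (forall d, D d.+1 + 13 <= G d.+1) -> (forall d, A d.+1 + 13 <= G d.+1) ->
  (forall d, G d.+1 + D d.+2 + 4 <= G d.+2) ->
  mid_bound p.+2 G.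
Proof.
move=> hD hA D0 A0 GD GA GG.
(* The terms that do not come from contraction take up at most half of the bound; the 13 in the
   exponents absorbs their coefficients. *)
have first_terms d w : 2 * ((mid_cost p.+1 d.+1 w)%:R + w%:R + 1)
    + 258 * ((mid_cost p d.+1 w)%:R + 2 * (w%:R + 1))
    <= 2 `^ G d.+1 / 2 * (w + d.+1)%:R.
  have := hA d w; have := hD d w.
  set a := 2 `^ A d.+1; set b := 2 `^ D d.+1; set g := 2 `^ G d.+1.
  set X := (w + d.+1)%:R; move=> hb ha.
  have X0 : 0 <= X by [].
  have aX : X <= a * X by rewrite ler_peMl // powR2_ge1.
  have bX : X <= b * X by rewrite ler_peMl // powR2_ge1.
  have ga : a * 2 ^+ 13 * X <= g * X.
    by rewrite ler_wpM2r // -powR2_nat -powR2D ler_powR2.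
  have gb : b * 2 ^+ 13 * X <= g * X.
    by rewrite ler_wpM2r // -powR2_nat -powR2D ler_powR2.
  have wX : w%:R + 1 <= X by rewrite natr1 ler_nat; lia.
  by lra.
elim=> [|d IH] w; rewrite mid_costSS whole_costSS.
  apply: le_trans (_ : 2 `^ G 1 / 2 * (w + 1)%:R <= _).
    apply: le_trans (first_terms 0 w).
    by rewrite (_ : mid_cost p.+2 0 _ = 0)// addn0 !(natrD, natrM) -!natr1; lra.
  by rewrite ler_wpM2r // ler_pdivrMr // ler_peMr ?powR_ge0 // ler1n.
have := first_terms d.+1 w; set K := (_ + 2 * _)%N => h1.
have h2 := IH K; have h3 := hD d.+1 w.
set b := 2 `^ D d.+2 in h3; set g := 2 `^ G d.+1 in h2.
set g2 := 2 `^ G d.+2 in h1 *; set X := (w + d.+2)%:R in h1 h3 *.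
have KE : K%:R = (mid_cost p d.+2 w)%:R + 2 * (w%:R + 1) :> R.
  by rewrite natrD natrM natr1.
have X0 : 0 <= X by [].
have g0 : 0 <= g by exact: powR_ge0.
(* The contracted term is at most [g * (b + 3) * X <= 4 * g * b * X], so the 4 in the exponent
   leaves it a quarter of the bound. *)
have gb : g * b * 2 ^+ 4 * X <= g2 * X.
  by rewrite ler_wpM2r // -powR2_nat -!powR2D ler_powR2.
have KX : (K + d.+1)%:R <= b * X + 3 * X.
  have : w%:R + 1 + d.+1%:R <= X by rewrite natr1 -natrD ler_nat; lia.
  have : 0 <= d.+1%:R :> R by []. have : 0 <= w%:R :> R by [].
  by rewrite natrD KE; lra.
have gX : 0 <= g * X by rewrite mulr_ge0.
have bX : g * X <= g * (b * X) by rewrite ler_wpM2l // ler_peMl // powR2_ge1.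
have gK : g * (K + d.+1)%:R <= g * (b * X + 3 * X) by rewrite ler_wpM2l.
rewrite natrD; apply: le_trans (lerD (lexx _) (le_trans h2 gK)) _.
by rewrite natrD !natrM KE natrD -[w.+1%:R]natr1; lra.
Qed.
End RealBounds.

(** * Exponents for any number of intervals *)

Section Exponents.
Variable R : realType.
Implicit Types (d w p t : nat) (C : R).

(** Rescaling by [k / ln 2] before applying [ln y < y] makes the slope as small as desired, at the
    price of a constant. *)
Lemma log2_le_linear k : (0 < k)%N ->
  exists2 c : R, 0 <= c & forall d, log2 d%:R <= d%:R / k%:R + c.
Proof.
move=> k0; have l0 := @ln2_gt0 R; have kR : 0 < k%:R :> R by rewrite ltr0n.
pose u : R := k%:R / ln 2.
have u0 : 0 < u by rewrite divr_gt0.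
exists `|log2 u|; first exact: normr_ge0.
move=> [|d]; first by rewrite /log2 ln0 // !mul0r add0r.
have d0 : 0 < d.+1%:R :> R by rewrite ltr0n.
have -> : log2 (d.+1%:R : R) = ln (d.+1%:R / u) / ln 2 + log2 u.
  by rewrite ln_div ?posrE // /log2 -mulrDl subrK.
apply: lerD (ler_norm _).
rewrite ler_pdivrMr //; apply: le_trans (ltW (ln_sublinear _)) _.
  by rewrite divr_gt0.
by rewrite /u invf_div mulrA [leRHS]mulrAC.
Qed.

Section PowerDifferences.
Variables (d t : nat).
Let x : R := d%:R.
Let e : R := d.+1%:R.

(** This is what lets a large [C] win: the increment of [C * d ^ (t + 1)] dominates error terms of
    order [d ^ t]. *)
Lemma pow_diff_ge : e ^+ t <= e ^+ t.+1 - x ^+ t.+1.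
Proof.
have e1 : e = x + 1 by rewrite /e -natr1.
have x0 : 0 <= x by [].
have : x * x ^+ t <= x * e ^+ t by rewrite ler_wpM2l // lerXn2r ?nnegrE // ler_nat.
have ee : e * e ^+ t = x * e ^+ t + e ^+ t by rewrite {1}e1 mulrDl mul1r.
by rewrite !exprS ee; lra.
Qed.

(** A discrete derivative of the power [t + 1], with a second-order error. The second bound is
    multiplied by [e] to avoid the exponent [t - 1], and its induction uses the first. *)
Lemma pow_diff_bounds :
  e ^+ t.+1 - x ^+ t.+1 <= t.+1%:R * e ^+ t /\
  t.+1%:R * e ^+ t.+1 <= e * (e ^+ t.+1 - x ^+ t.+1) + t.+1%:R ^+ 2 * e ^+ t.
Proof.
have e1 : e = x + 1 by rewrite /e -natr1.
have x0 : 0 <= x by []. have e0 : 0 <= e by [].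
elim: t => [|k [IH1 IH2]]; first by rewrite !expr1 expr0; lra.
have -> : e ^+ k.+2 - x ^+ k.+2 = e ^+ k.+1 + e * (e ^+ k.+1 - x ^+ k.+1) - (e ^+ k.+1 - x ^+ k.+1).
  by rewrite (exprS x k.+1) (exprS e k.+1) e1; ring.
have diff0 : 0 <= e ^+ k.+1 - x ^+ k.+1.
  by rewrite subr_ge0 lerXn2r ?nnegrE // ler_nat.
set D := _ - _ in IH1 IH2 diff0 *.
rewrite -[k.+2%:R]natr1 (exprS e k.+1).
have ek : e * e ^+ k = e ^+ k.+1 by rewrite -exprS.
have P0 : 0 <= e ^+ k.+1 by rewrite exprn_ge0.
have h1 : e * D <= k.+1%:R * e ^+ k.+1 by rewrite -ek mulrCA ler_wpM2l.
have h2 : e * (k.+1%:R * e ^+ k.+1) <= e * (e * D) + k.+1%:R ^+ 2 * e ^+ k.+1.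
  by rewrite -{2}ek [k.+1%:R ^+ 2 * _]mulrCA -mulrDr ler_wpM2l.
set P := e ^+ k.+1 in P0 h1 h2 *; set K : R := k.+1%:R in h1 h2 *.
have K0 : 0 <= K by [].
have KP : 0 <= K * P by rewrite mulr_ge0.
by split; lra.
Qed.

Lemma pow_diff_mul (l : R) : 0 <= l <= e ->
  t.+1%:R * e ^+ t * l <= l * (e ^+ t.+1 - x ^+ t.+1) + t.+1%:R ^+ 2 * e ^+ t.
Proof.
move=> /andP[l0 le]; have [_ h] := pow_diff_bounds.
have e0 : 0 < e by rewrite ltr0n.
rewrite -(ler_pM2l e0).
have := ler_wpM2l l0 h; rewrite exprS; set D := _ - _.
have : l * (t.+1%:R ^+ 2 * e ^+ t) <= e * (t.+1%:R ^+ 2 * e ^+ t).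
  by rewrite ler_wpM2r // mulr_ge0 ?exprn_ge0 // ltW.
by lra.
Qed.

End PowerDifferences.

Lemma pow_diff_lower d t :
  t.+2%:R * d.+1%:R ^+ t.+1 <=
    d.+1%:R ^+ t.+2 - d%:R ^+ t.+2 + t.+2%:R ^+ 2 * d.+1%:R ^+ t :> R.
Proof.
have [_ h] := pow_diff_bounds d t.+1.
have e0 : 0 < d.+1%:R :> R by rewrite ltr0n.
rewrite -(ler_pM2l e0) mulrDr mulrCA -exprS [X in _ + X]mulrCA -exprS; exact: h.
Qed.

(** [log_exponent t] and [poly_exponent t] serve [2 * t + 4] and [2 * t + 5] intervals; the shift of
    [t] in the latter lets both families start at 0. *)
Definition log_exponent t C d : R :=
  1 / (t`!)%:R * d%:R ^+ t * log2 d%:R + C * d%:R ^+ t.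

Definition poly_exponent t C d : R :=
  1 / (t.+1`!)%:R * d%:R ^+ t.+1 + C * d%:R ^+ t.

Lemma fact_inv t : [/\ 0 <= 1 / (t`!)%:R :> R, 1 / (t`!)%:R <= 1 :> R
  & 1 / (t`!)%:R = t.+1%:R * (1 / (t.+1`!)%:R) :> R].
Proof.
have f0 : 0 < (t`!)%:R :> R by rewrite ltr0n fact_gt0.
split; first by rewrite divr_ge0.
  by rewrite ler_pdivrMr // mul1r ler1n fact_gt0.
rewrite factS natrM; field.
by rewrite nat1r !pnatr_eq0 -lt0n fact_gt0.
Qed.

Lemma pow_facts d t : [/\ 1 <= d.+1%:R ^+ t :> R,
  d.+1%:R ^+ t <= d.+1%:R ^+ t.+1 :> R
  & d.+1%:R ^+ t * log2 d.+1%:R <= d.+1%:R ^+ t.+1 :> R].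
Proof.
have d1 : 1 <= d.+1%:R :> R by rewrite ler1n.
split; [exact: exprn_ege1|by rewrite ler_weXn2l|].
by rewrite exprSr ler_wpM2l ?log2_le // exprn_ge0.
Qed.

(** The increment of [d ^ (t + 1) * log2 d / (t + 1)!] is at least [d ^ t * log2 d / t!] up to
    [O(d ^ t)], which the increment of [C * d ^ (t + 1)] absorbs. *)
Lemma mid_bound_log_step t C1 C2 : 0 <= C1 -> 0 <= C2 ->
  mid_bound t.*2.+1 (log_exponent t C1) -> mid_bound t.*2.+2 (poly_exponent t C2) ->
  exists2 C, 0 <= C & mid_bound t.+1.*2.+1 (log_exponent t.+1 C).
Proof.
move=> C10 C20 h1 h2; have s0 : 0 <= t.+1%:R ^+ 2 :> R by [].
pose C := C1 + C2 + t.+1%:R ^+ 2 + 14; have C0 : 0 <= C by rewrite /C; lra.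
exists C => //; rewrite doubleS.
have [f0 f1 _] := fact_inv t.+1; have [f0' f1' ff] := fact_inv t.
apply: (mid_bound_step h1 h2) => d; rewrite /log_exponent /poly_exponent.
- by apply: addr_ge0; [rewrite mulr_ge0 ?log2_ge0 // mulr_ge0|rewrite mulr_ge0].
- by rewrite addr_ge0 // mulr_ge0.
- have [p1 pS pl] := pow_facts d t; have l0 := @log2_ge0 R d.+1.
  set u := d.+1%:R ^+ t in p1 pS pl *; set P := d.+1%:R ^+ t.+1 in pS pl *.
  set l := log2 _ in pl l0 *.
  have a1 : 0 <= 1 / (t.+1`!)%:R * P * l by rewrite mulr_ge0 // mulr_ge0 //; lra.
  have a2 : 1 / (t`!)%:R * (u * l) <= 1 * (u * l) by rewrite ler_wpM2r // mulr_ge0 //; lra.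
  have a3 : C1 * u <= C1 * P by rewrite ler_wpM2l.
  have a4 : (C1 + 14) * P <= C * P by rewrite ler_wpM2r /C; lra.
  by lra.
- have [p1 pS pl] := pow_facts d t; have l0 := @log2_ge0 R d.+1.
  set u := d.+1%:R ^+ t in p1 pS pl *; set P := d.+1%:R ^+ t.+1 in pS pl *.
  set l := log2 _ in pl l0 *.
  have a1 : 0 <= 1 / (t.+1`!)%:R * P * l by rewrite mulr_ge0 // mulr_ge0 //; lra.
  have a2 : 1 / (t.+1`!)%:R * P <= 1 * P by rewrite ler_wpM2r //; lra.
  have a3 : C2 * u <= C2 * P by rewrite ler_wpM2l.
  have a4 : (C2 + 14) * P <= C * P by rewrite ler_wpM2r /C; lra.
  by lra.
have [p1 _ _] := pow_facts d.+1 t.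
have hB := pow_diff_ge d.+1 t.
have hA := @pow_diff_mul d.+1 t (log2 d.+2%:R).
rewrite log2_ge0 log2_le in hA; have {}hA := hA isT.
have ll : log2 d.+1%:R <= log2 d.+2%:R :> R by rewrite log2_mono.
rewrite ff; set f := 1 / _ in f0 f1 *; set u := d.+2%:R ^+ t in p1 hB hA *.
set P := d.+2%:R ^+ t.+1 in hB hA *; set Q := d.+1%:R ^+ t.+1 in hB hA *.
set l := log2 d.+2%:R in ll hA *; set l' := log2 d.+1%:R in ll *.
have Q0 : 0 <= Q by rewrite exprn_ge0.
have a1 : f * (Q * l') <= f * (Q * l) by rewrite !ler_wpM2l.
have a2 := ler_wpM2l f0 hA.
have a3 : C * u <= C * (P - Q) by rewrite ler_wpM2l.
have a4 : f * (t.+1%:R ^+ 2 * u) <= 1 * (t.+1%:R ^+ 2 * u).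
  by rewrite ler_wpM2r // mulr_ge0 //; lra.
have a5 : (C1 + t.+1%:R ^+ 2 + 14) * u <= C * u by rewrite ler_wpM2r /C; lra.
by lra.
Qed.

(** The logarithmic exponent must also stay below the new one. For this [log2] is bounded with slope
    [1 / (t + 2)], which cancels the quotient of the two factorials. *)
Lemma mid_bound_poly_step t C2 C3 : 0 <= C2 -> 0 <= C3 ->
  mid_bound t.*2.+2 (poly_exponent t C2) -> mid_bound t.*2.+3 (log_exponent t.+1 C3) ->
  exists2 C, 0 <= C & mid_bound t.+1.*2.+2 (poly_exponent t.+1 C).
Proof.
move=> C20 C30 h1 h2; have s0 : 0 <= t.+2%:R ^+ 2 :> R by [].
have [c c0 hc] := log2_le_linear (ltn0Sn t.+1).
pose C := C2 + C3 + c + t.+2%:R ^+ 2 + 14; have C0 : 0 <= C by rewrite /C; lra.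
exists C => //; rewrite doubleS.
have [f0 f1 _] := fact_inv t.+2; have [f0' f1' ff] := fact_inv t.+1.
apply: (mid_bound_step h1 h2) => d; rewrite /log_exponent /poly_exponent.
- by rewrite addr_ge0 // mulr_ge0.
- by apply: addr_ge0; [rewrite mulr_ge0 ?log2_ge0 // mulr_ge0|rewrite mulr_ge0].
- have [p1 pS _] := pow_facts d t; have [_ pS' _] := pow_facts d t.+1.
  set u := d.+1%:R ^+ t in p1 pS *; set P := d.+1%:R ^+ t.+1 in pS pS' *.
  set Q := d.+1%:R ^+ t.+2 in pS' *.
  have a1 : 0 <= 1 / (t.+2`!)%:R * Q by rewrite mulr_ge0 //; lra.
  have a2 : 1 / (t.+1`!)%:R * P <= 1 * P by rewrite ler_wpM2r //; lra.
  have a3 : C2 * u <= C2 * P by rewrite ler_wpM2l.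
  have a4 : (C2 + 14) * P <= C * P by rewrite ler_wpM2r /C; lra.
  by lra.
- have [p1 _ _] := pow_facts d t.+1.
  have a1 := hc d.+1; rewrite ff.
  have eP : d.+1%:R ^+ t.+2 = d.+1%:R ^+ t.+1 * d.+1%:R :> R by rewrite exprSr.
  rewrite eP; set P := d.+1%:R ^+ t.+1 in p1 *.
  set f := 1 / _ in f0 f1 ff *; set x : R := d.+1%:R in a1 *.
  have T0 : 0 < t.+2%:R :> R by rewrite ltr0n.
  have a2 : t.+2%:R * f * P * log2 x <= f * (P * x) + t.+2%:R * f * (P * c).
    have -> : f * (P * x) + t.+2%:R * f * (P * c) = t.+2%:R * f * P * (x / t.+2%:R + c).
      by field; rewrite gt_eqF.
    by rewrite ler_wpM2l // !mulr_ge0 //; lra.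
  have a4 : t.+2%:R * f * (P * c) <= 1 * (P * c).
    by rewrite -ff ler_wpM2r // mulr_ge0 //; lra.
  have a5 : (C3 + c + 14) * P <= C * P by rewrite ler_wpM2r /C; lra.
  move: a2 a4 a5 p1; clear; set l := log2 x.
  by lra.
have [p1 _ _] := pow_facts d.+1 t.
have hB := pow_diff_ge d.+1 t.
have hA := pow_diff_lower d.+1 t.
rewrite ff; set f := 1 / _ in f0 f1 *; set u := d.+2%:R ^+ t in p1 hB hA *.
set P := d.+2%:R ^+ t.+1 in hB hA *; set Q := d.+1%:R ^+ t.+1 in hB *.
set P' := d.+2%:R ^+ t.+2 in hA *; set Q' := d.+1%:R ^+ t.+2 in hA *.
have a2 := ler_wpM2l f0 hA.
have a3 : C * u <= C * (P - Q) by rewrite ler_wpM2l.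
have a4 : f * (t.+2%:R ^+ 2 * u) <= 1 * (t.+2%:R ^+ 2 * u).
  by rewrite ler_wpM2r // mulr_ge0 //; lra.
have a5 : (C2 + t.+2%:R ^+ 2 + 14) * u <= C * u by rewrite ler_wpM2r /C; lra.
by lra.
Qed.

(** The exponent 11 suffices since [2 ^ 11] exceeds [600 * 2]. *)
Lemma mid_bound_log0 : mid_bound 1 (log_exponent 0 11).
Proof.
move=> d w; rewrite /log_exponent fact0 divr1 !expr0 !mul1r mulr1 powR2D.
rewrite powR2_log2 ?ltr0n // powR2_nat.
apply: le_trans (_ : (600 * d.+1 * (w + 2 * d.+1))%:R <= _).
  by rewrite ler_nat mid_cost1.
rewrite !(natrD, natrM).
have : 0 <= d.+1%:R * w%:R :> R by rewrite mulr_ge0.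
have : 0 <= d.+1%:R * d.+1%:R :> R by rewrite mulr_ge0.
by lra.
Qed.

(** The exponent 20 suffices since [2 ^ 20 = 1048576] exceeds [4000 * 262 = 1048000]. *)
Lemma mid_bound_poly0 : mid_bound 2 (poly_exponent 0 20).
Proof.
move=> d w; rewrite /poly_exponent factS fact0 muln1 divr1 expr0 expr1 mul1r mulr1 powR2D.
rewrite !powR2_nat.
apply: le_trans (_ : (4000 * 2 ^ d.+1 * (w + 262 * d.+1))%:R <= _).
  by rewrite ler_nat (leq_trans _ (mid_cost2 d.+1 w)) // leq_addr.
rewrite !(natrD, natrM) natrX.
have e0 : 0 <= 2 ^+ d.+1 :> R by [].
have : 0 <= 2 ^+ d.+1 * w%:R :> R by rewrite mulr_ge0.
have : 0 <= 2 ^+ d.+1 * d.+1%:R :> R by rewrite mulr_ge0.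
by lra.
Qed.

Lemma mid_bounds t :
  (exists2 C, 0 <= C & mid_bound t.*2.+1 (log_exponent t C)) /\
  (exists2 C, 0 <= C & mid_bound t.*2.+2 (poly_exponent t C)).
Proof.
elim: t => [|t [[C1 C10 h1] [C2 C20 h2]]].
  by split; [exists 11 => //; exact: mid_bound_log0|exists 20 => //; exact: mid_bound_poly0].
have [C3 C30 h3] := mid_bound_log_step C10 C20 h1 h2.
split; first by exists C3.
exact: mid_bound_poly_step C20 C30 h2 h3.
Qed.

End Exponents.

Lemma form_threshold_mid p d :
  form_threshold p.+3 d = (p.+3 + (2 * 4096).+1 * (mid_cost p d 1 + 5))%N.
Proof.
rewrite /form_threshold (_ : (maxn p.+3 2).-1 = p.+2); last by lia.
by rewrite whole_costSS; lia.
Qed.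

(** Two intervals are reached by a single trimming, whose cost does not depend on the level. *)
Lemma form_threshold2 d : form_threshold 2 d = form_threshold 2 0.
Proof. by congr (_ + _ * (_ + 1))%N; rewrite !whole_costS. Qed.

(** * Growth of the thresholds and choice of zeta *)

Section Thresholds.
(* Keeps [done] from evaluating the large unary constants in it. *)
Local Opaque form_threshold.
Variable R : realType.
Implicit Types (s d n t : nat) (C : R).

Local Notation N s d := ((form_threshold s d)%:R : R).
Local Notation a n := ((inv_ackermann n)%:R : R).

Lemma inv_ackermann_pred n : exists d, inv_ackermann n = d.+1.
Proof.
rewrite /inv_ackermann; case: ex_minnP => -[|d] /andP[] // _ _ _.
by exists d.
Qed.

Lemma bigO_of_le (f g : nat -> R) C :
  (forall n, 0 <= f n <= C * g n) -> (forall n, 0 <= g n) -> f =O_\oo g.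
Proof.
move=> fg g0; apply/eqO_exP; exists (`|C| + 1); first by rewrite ltr_wpDl.
apply: nearW => n; have /andP[f0 fC] := fg n.
rewrite (ger0_norm f0) (ger0_norm (g0 n)) (le_trans fC) // ler_wpM2r //.
by rewrite (le_trans (ler_norm C)) // lerDl.
Qed.

Lemma form_threshold_bigO2 : (fun n => N 2 (inv_ackermann n)) =O_\oo (fun=> 1 : R).
Proof.
apply: (@bigO_of_le _ _ (N 2 0)) => [n|_]; last exact: ler01.
by rewrite form_threshold2 mulr1 lexx ler0n.
Qed.

Lemma form_threshold_bigO s (g : nat -> R) C : 0 <= C ->
  (forall d, 0 <= g d.+1 /\ N s d.+1 <= C * g d.+1) ->
  (fun n => N s (inv_ackermann n)) =O_\oo (fun n => g (inv_ackermann n)).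
Proof.
move=> C0 gC; apply: (@bigO_of_le _ _ C) => n; have [d ->] := inv_ackermann_pred n.
  by have [_ ->] := gC d; rewrite ler0n.
by have [] := gC d.
Qed.

Lemma form_threshold_le p : exists2 c : nat, (0 < c)%N & forall d (X : R),
  1 <= X -> (mid_cost p d 1)%:R <= X -> N p.+3 d <= c%:R * X.
Proof.
have bound (k d : nat) (X : R) : 1 <= X -> (mid_cost p d 1)%:R <= X ->
    (p.+3 + k * (mid_cost p d 1 + 5))%:R <= (p.+3 + k * 6)%:R * X.
  move=> X1 mX; rewrite !(natrD, natrM).
  have h1 : p.+3%:R <= p.+3%:R * X by rewrite ler_peMr.
  have h2 : k%:R * ((mid_cost p d 1)%:R + 5) <= k%:R * (6 * X) by rewrite ler_wpM2l //; lra.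
  by lra.
eexists; last by move=> d X X1 mX; rewrite form_threshold_mid; apply: bound.
by rewrite addSn.
Qed.

Lemma form_threshold_bigO3 : (fun n => N 3 (inv_ackermann n)) =O_\oo (fun n => a n).
Proof.
have [c _ hc] := form_threshold_le 0.
apply: (@form_threshold_bigO 3 (fun d => d%:R) (c%:R * 260)) => [|d].
  by rewrite mulr_ge0 ?ler0n.
split; first exact: ler0n.
rewrite -mulrA; have d1 : 1 <= d.+1%:R :> R by rewrite ler1n.
by apply: hc; rewrite ?mid_cost0 ?natrM //; lra.
Qed.

Lemma form_threshold_bigO4 :
  (fun n => N 4 (inv_ackermann n)) =O_\oo (fun n => a n ^+ 2).
Proof.
have [c _ hc] := form_threshold_le 1.
apply: (@form_threshold_bigO 4 (fun d => d%:R ^+ 2) (c%:R * 1800)) => [|d].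
  by rewrite mulr_ge0 ?ler0n.
split; first exact: exprn_ge0.
rewrite -mulrA; have d1 : 1 <= d.+1%:R :> R by rewrite ler1n.
have dd : d.+1%:R <= d.+1%:R ^+ 2 :> R by rewrite ler_eXnr.
apply: hc; first by lra.
apply: le_trans (_ : (600 * d.+1 * (1 + 2 * d.+1))%:R <= _).
  by rewrite ler_nat mid_cost1.
by rewrite !(natrM, natrD); lra.
Qed.

Lemma form_threshold_bigO5 :
  (fun n => N 5 (inv_ackermann n)) =O_\oo (fun n => a n * 2 `^ a n).
Proof.
have [c _ hc] := form_threshold_le 2.
apply: (@form_threshold_bigO 5 (fun d => d%:R * 2 `^ d%:R) (c%:R * (4000 * 263))) => [|d].
  by rewrite !mulr_ge0 ?ler0n.
split; first by rewrite mulr_ge0 ?powR_ge0.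
rewrite powR2_nat -mulrA; have d1 : 1 <= d.+1%:R :> R by rewrite ler1n.
have e1 : 1 <= 2 ^+ d.+1 :> R by rewrite exprn_ege1 // ler1n.
have ed : 2 ^+ d.+1 <= d.+1%:R * 2 ^+ d.+1 :> R by rewrite ler_peMl // (le_trans _ e1).
apply: hc; first by lra.
apply: le_trans (_ : (4000 * 2 ^ d.+1 * (1 + 262 * d.+1))%:R <= _).
  by rewrite ler_nat (leq_trans _ (mid_cost2 d.+1 1)) // leq_addr.
by rewrite !(natrM, natrD) natrX; lra.
Qed.

Lemma log_exponent_ge0 t C d : 0 <= C -> 0 <= log_exponent t C d.
Proof.
move=> C0; rewrite /log_exponent.
by apply: addr_ge0; [rewrite mulr_ge0 ?log2_ge0 // mulr_ge0|rewrite mulr_ge0].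
Qed.

Lemma poly_exponent_ge0 t C d : 0 <= C -> 0 <= poly_exponent t C d.
Proof. by move=> C0; rewrite /poly_exponent addr_ge0 // mulr_ge0. Qed.

(** The constant factor is at most [2 ^ c] and the linear factor at most [2 ^ (d + 1)], so both move
    into the exponent. *)
Lemma form_threshold_exp p (E : nat -> R) : mid_bound p E ->
  (forall d, 0 <= E d.+1) ->
  exists2 c : R, 0 <= c & forall d, N p.+3 d.+1 <= 2 `^ (E d.+1 + d.+1%:R + c).
Proof.
move=> hE E0; have [c _ hc] := form_threshold_le p; exists c%:R => // d.
have h1 : 1 <= 2 `^ E d.+1 :> R by rewrite powR2_ge1.
have lt2 k : k%:R <= 2 `^ k%:R :> R.
  by rewrite powR2_nat -natrX ler_nat ltnW // ltn_expl.
apply: (@le_trans _ _ (c%:R * (2 `^ E d.+1 * (1 + d.+1)%:R))).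
  apply: hc => //; apply: le_trans h1 _.
  by rewrite ler_peMr ?powR_ge0 // ler1n.
rewrite mulrC !powR2D; apply: ler_pM => //.
rewrite ler_wpM2l ?powR_ge0 // powR2_nat -natrX ler_nat.
by rewrite add1n ltn_expl.
Qed.

Lemma eq_exp2_bigO_add (g h : nat -> R) C : (forall n, 0 <= h n) -> 0 <= C ->
  eq_exp2_bigO (fun n => 2 `^ (g n + C * h n)) g h.
Proof.
move=> h0 C0; exists (fun n => C * h n) => //.
by apply: (@bigO_of_le _ _ C) => // n; rewrite lexx mulr_ge0.
Qed.

(** The asymptotic form is an equality, so the threshold is replaced by an upper bound of exactly
    that form. The additional linear term fits into the error because [t - 1 >= 1]. *)
Lemma odd_threshold_exp t : (2 <= t)%N ->
  exists2 z : nat -> R, (forall n, N (2 * t + 3) (inv_ackermann n) <= z n) &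
    eq_exp2_bigO z (fun n => 1 / (t`!)%:R * a n ^+ t) (fun n => a n ^+ (t - 1)).
Proof.
case: t => [|[|t]] // _; have [_ [C C0 hC]] := mid_bounds R t.+1.
have [c c0 hc] := form_threshold_exp hC (fun d => poly_exponent_ge0 t.+1 d.+1 C0).
exists (fun n => 2 `^ (1 / (t.+2`!)%:R * a n ^+ t.+2 + (C + 1 + c) * a n ^+ (t.+2 - 1))).
  move=> n; have [d ->] := inv_ackermann_pred n.
  rewrite (_ : (2 * t.+2 + 3)%N = t.+1.*2.+2.+3); last by lia.
  apply: le_trans (hc d) _.
  rewrite ler_powR2 // subn1 /poly_exponent -!addrA lerD2l [t.+2.-1]/=.
  have d1 : 1 <= d.+1%:R :> R by rewrite ler1n.
  have p1 : d.+1%:R <= d.+1%:R ^+ t.+1 :> R by rewrite ler_eXnr.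
  have c1 : c <= c * d.+1%:R ^+ t.+1 by rewrite ler_peMr // (le_trans d1).
  by lra.
by apply: eq_exp2_bigO_add => [n|]; rewrite ?addr_ge0.
Qed.

Lemma even_threshold_exp t : (1 <= t)%N ->
  exists2 z : nat -> R, (forall n, N (2 * t + 4) (inv_ackermann n) <= z n) &
    eq_exp2_bigO z (fun n => 1 / (t`!)%:R * a n ^+ t * log2 (a n)) (fun n => a n ^+ t).
Proof.
case: t => [|t] // _; have [[C C0 hC] _] := mid_bounds R t.+1.
have [c c0 hc] := form_threshold_exp hC (fun d => log_exponent_ge0 t.+1 d.+1 C0).
exists (fun n => 2 `^ (1 / (t.+1`!)%:R * a n ^+ t.+1 * log2 (a n) + (C + 1 + c) * a n ^+ t.+1)).
  move=> n; have [d ->] := inv_ackermann_pred n.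
  rewrite (_ : (2 * t.+1 + 4)%N = t.+1.*2.+1.+3); last by lia.
  apply: le_trans (hc d) _.
  rewrite ler_powR2 // /log_exponent -!addrA lerD2l.
  have d1 : 1 <= d.+1%:R :> R by rewrite ler1n.
  have p1 : d.+1%:R <= d.+1%:R ^+ t.+1 :> R by rewrite ler_eXnr.
  have c1 : c <= c * d.+1%:R ^+ t.+1 by rewrite ler_peMr // (le_trans d1).
  by lra.
by apply: eq_exp2_bigO_add => [n|]; rewrite ?addr_ge0.
Qed.

(** Up to 5 intervals the threshold itself is taken. Beyond that, [s] determines both its parity
    class and [t], so exactly one of the exponential forms applies. *)
Lemma zeta_exists s : exists z : nat -> R,
  [/\ forall n, N s (inv_ackermann n) <= z n,
    (s <= 5)%N -> z = fun n => N s (inv_ackermann n),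
    forall t, (2 <= t)%N -> s = (2 * t + 3)%N ->
      eq_exp2_bigO z (fun n => 1 / (t`!)%:R * a n ^+ t) (fun n => a n ^+ (t - 1))
  & forall t, (1 <= t)%N -> s = (2 * t + 4)%N ->
      eq_exp2_bigO z (fun n => 1 / (t`!)%:R * a n ^+ t * log2 (a n)) (fun n => a n ^+ t)].
Proof.
case: (leqP s 5) => s5.
  by exists (fun n => N s (inv_ackermann n)); split=> // t; lia.
have [[t t2 sE]|[t t1 sE]] : (exists2 t, (2 <= t)%N & s = (2 * t + 3)%N) \/
    (exists2 t, (1 <= t)%N & s = (2 * t + 4)%N).
- by case: (boolP (odd s)) => so; [left; exists (s - 3)./2|right; exists (s - 4)./2]; lia.
- have [z zN zE] := odd_threshold_exp t2; exists z; rewrite sE.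
  split=> [//|?|t' _ tt'|t' _ ?]; try by exfalso; lia.
  by have -> : t' = t by lia.
- have [z zN zE] := even_threshold_exp t1; exists z; rewrite sE.
  split=> [//|?|t' _ ?|t' _ tt']; try by exfalso; lia.
  by have -> : t' = t by lia.
Qed.

End Thresholds.

Unset Implicit Arguments.

Theorem lemma1p4 (R : realType) :
  exists zeta : nat -> nat -> R,
    let a (n : nat) : R := (inv_ackermann n)%:R in
    [/\ [/\ zeta 2%N =O_\oo (fun _ : nat => 1 : R),
            zeta 3%N =O_\oo (fun n => a n),
            zeta 4%N =O_\oo (fun n => a n ^+ 2)
          & zeta 5%N =O_\oo (fun n => a n * 2 `^ a n)],
        (forall t : nat, (2 <= t)%N ->
          eq_exp2_bigO (zeta (2 * t + 3)%N)
            (fun n => 1 / (t`!)%:R * a n ^+ t)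
            (fun n => a n ^+ (t - 1))),
        (forall t : nat, (1 <= t)%N ->
          eq_exp2_bigO (zeta (2 * t + 4)%N)
            (fun n => 1 / (t`!)%:R * a n ^+ t * log2 (a n))
            (fun n => a n ^+ t)),
        (forall s n B : nat, (0 < s)%N -> (0 < n)%N -> (0 < B)%N ->
          forall M : 'M[bool]_(n, n),
            zeta s n * B%:R * n%:R <= (ones M)%:R ->
            contains_fat_formation B B s M)
      & (forall m n s B : nat,
          (0 < m)%N -> (0 < n)%N -> (0 < s)%N -> (0 < B)%N ->
          forall M : 'M[bool]_(m, n),
            zeta s m * B%:R * n%:R <= (ones M)%:R ->
            contains_fat_formation B ((n * B) %/ m)%N s M)].
Proof.
have [zeta hz] := choice (@zeta_exists R).
have general m n s B : (0 < m)%N -> (0 < n)%N -> (0 < s)%N -> (0 < B)%N ->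
    forall M : 'M[bool]_(m, n), zeta s m * B%:R * n%:R <= (ones M)%:R ->
    contains_fat_formation B ((n * B) %/ m)%N s M.
  move=> m0 n0 s0 B0 M hM; apply: fat_formation_threshold => //.
  have [zN _ _ _] := hz s; rewrite -(ler_nat R) !natrM.
  by apply: le_trans hM; rewrite !ler_wpM2r.
have small s : (s <= 5)%N -> zeta s = fun n => (form_threshold s (inv_ackermann n))%:R.
  by have [_ + _ _] := hz s.
exists zeta => a; split.
- split; rewrite small //.
  + exact: form_threshold_bigO2.
  + exact: form_threshold_bigO3.
  + exact: form_threshold_bigO4.
  + exact: form_threshold_bigO5.
- by move=> t t2; have [_ _ + _] := hz (2 * t + 3)%N; apply.
- by move=> t t1; have [_ _ _ +] := hz (2 * t + 4)%N; apply.
- move=> s n B s0 n0 B0 M hM.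
  (* For a square matrix, [n * B %/ n] is [B]. *)
  by have := general n n s B n0 n0 s0 B0 M hM; rewrite mulKn.
- exact: general.
Qed.
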